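(* Let $Z<0$, $N\ge 2$ and fix $n\in\{1,\dots,N-1\}$. Let $$\omega_n^*=\frac{\big(n^{2/3}+(N-n)^{2/3}\big)^3}{Z^2},\qquad \widehat\omega=\frac{2N^2}{Z^2}.$$ Then for every $\omega>\omega_n^*$ (with $\omega\ne\widehat\omega$ in the case $2n>N$) there exist two shifts $0<a_A(\omega)<a_B(\omega)$, with $a_A(\omega)$ of type $A$ and $a_B(\omega)$ of type $B$, and a choice $\{a_1,a_N\}=\{a_A(\omega),a_B(\omega)\}$, such that the stationary profile $$\Theta_{\omega,n}=(\underbrace{\Psi_{a_1},\dots,\Psi_{a_1}}_{n},\underbrace{\Psi_{a_N},\dots,\Psi_{a_N}}_{N-n})$$ belongs to $D(\mathcal H_Z^{\delta'})$. Moreover, these shifts can be chosen (and extended to $\omega=\widehat\omega$ when $2n>N$) so that the map $$(\omega_n^*,\infty)\ni\omega\longmapsto e^{it\omega}\Theta_{\omega,n}\in D(\mathcal H_Z^{\delta'})$$ defines a smooth curve of standing wave solutions of the cubic NLS on $\mathcal G$, which are discontinuous at the vertex (for $\omega\neq\widehat\omega$ in the case $2n>N$). The assignment of shift types is the following: 1) If $2n\le N$, then $a_1=a_A(\omega)$ and $a_N=a_B(\omega)$ for every $\omega>\omega_n^*$ (exactly $n$ type-$A$ components and $N-n$ type-$B$ components). 2) If $2n>N$, then $$\begin{cases} a_1=a_A(\omega),\ a_N=a_B(\omega), & \omega>\widehat\omega,\\ a_1=a_B(\omega),\ a_N=a_A(\omega), & \omega_n^*<\omega<\widehat\omega,\end{cases}$$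 and at $\omega=\widehat\omega$ the two shift types reverse, collapsing into a continuous configuration $a_A(\omega)=a_B(\omega)=\operatorname{arctanh}(1/\sqrt2)$.
   Context: Star graph: $\mathcal G$ consists of $N$ half-lines, each identified with $[L,\infty)$, $L\ge 0$, joined at the common vertex $x=L$. Functions on $\mathcal G$ are $N$-tuples $\mathbf U=(\psi_1,\dots,\psi_N)$, $\psi_j:[L,\infty)\to\mathbb C$; $L^2(\mathcal G)=\bigoplus_{j=1}^N L^2(L,\infty)$, $H^k(\mathcal G)=\bigoplus_{j=1}^N H^k(L,\infty)$ (no vertex condition is imposed). A function is continuous at the vertex if $\psi_1(L)=\dots=\psi_N(L)$, and discontinuous otherwise. Operator: $\mathcal H_Z^{\delta'}(\psi_j)_j=(-\psi_j'')_j$ with domain $$D(\mathcal H_Z^{\delta'})=\Big\{\mathbf U\in H^2(\mathcal G):\ \psi_1'(L)=\dots=\psi_N'(L),\ \sum_{j=1}^N\psi_j(L)=Z\psi_1'(L)\Big\},$$ equipped with the $H^2(\mathcal G)$ topology. Cubic NLS: $i\mathbf U_t-\mathcal H_Z^{\delta'}\mathbf U+|\mathbf U|^2\mathbf U=\mathbf 0$ (componentwise nonlinearity). A standing wave is a solution $e^{i\omega t}\Theta(x)$ with $\Theta\in D(\mathcal H_Z^{\delta'})$; equivalently $\mathcal H_Z^{\delta'}\Theta+\omega\Theta-|\Theta|^2\Theta=\mathbf 0$. Profiles: for $\omega>0$, $a>0$, $\Psi_a(x)=\sqrt{2\omega}\,\operatorname{sech}(\sqrt\omega(x-L)+a)$,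 $x\ge L$. A shift $a$ (or the profile $\Psi_a$) is of type $A$ if $0<a<a_*$ and of type $B$ if $a>a_*$, where $a_*=\operatorname{arctanh}(1/\sqrt2)$. *)

(* Defs.v *)
From mathcomp Require Import all_boot all_order all_algebra.
From mathcomp Require Import all_classical all_reals all_analysis.
From mathcomp Require Import complex.

Set Implicit Arguments.
Unset Strict Implicit.
Unset Printing Implicit Defensive.

Import Order.TTheory GRing.Theory Num.Theory.
Import numFieldNormedType.Exports.
Import Normc.

Local Open Scope classical_set_scope.
Local Open Scope ring_scope.
Local Open Scope complex_scope.

(* A function on the star graph with N edges [L, +oo) is an N-tuple of functions
   R -> C.  Only the values at points x >= L are meaningful: every notion below
   ignores the values at x < L. *)
Definition gfun (R : realType) (N : nat) := 'I_N -> R -> R[i].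

Section halfline.
Context {R : realType}.
Variable L : R.
Implicit Types f g : R -> R[i].

Definition halfline : set R := `[L, +oo[.

Definition cintegral f : R[i] :=
  (\int[lebesgue_measure]_(x in halfline) complex.Re (f x)) +i*
  (\int[lebesgue_measure]_(x in halfline) complex.Im (f x)).

Definition L2_sqnorm f : \bar R :=
  (\int[lebesgue_measure]_(x in halfline) ((normc (f x)) ^+ 2)%:E)%E.

Definition L2 f : Prop :=
  [/\ measurable_fun halfline (fun x => complex.Re (f x)),
      measurable_fun halfline (fun x => complex.Im (f x)) &
      (L2_sqnorm f < +oo)%E].

Definition continuous_on_halfline f : Prop :=
  {within halfline, continuous (fun x => complex.Re (f x))} /\
  {within halfline, continuous (fun x => complex.Im (f x))}.

(* phi is the extension by zero of an element of C_c^oo((L, +oo), R). *)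
Definition test_function (phi : R -> R) : Prop :=
  (forall (k : nat) (x : R), derivable (derive1n k phi) x 1) /\
  (exists a b : R, L < a /\ forall x, phi x != 0 -> a <= x <= b).

Definition weak_derivative f g : Prop :=
  forall phi, test_function phi ->
    cintegral (fun x => f x * (derive1 phi x)%:C) =
    - cintegral (fun x => g x * (phi x)%:C).

(* f is in H^2(L, +oo) with weak derivatives f1 = f' and f2 = f''.  As usual, f
   and f' stand for their continuous representatives on [L, +oo), so that their
   values at the vertex are f L and f1 L; f2 is determined only almost
   everywhere. *)
Record H2_derivs f f1 f2 : Prop := {
  H2_L2 : L2 f;
  H2_L2_deriv : L2 f1;
  H2_L2_deriv2 : L2 f2;
  H2_deriv : weak_derivative f f1;
  H2_deriv2 : weak_derivative f1 f2;
  H2_cont : continuous_on_halfline f;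
  H2_cont_deriv : continuous_on_halfline f1 }.

End halfline.

Section star_graph.
Context {R : realType}.
Variables (L : R) (N : nat).
Implicit Types (U V : gfun R N) (Z omega : R).

Definition L2G_sqnorm U : \bar R := (\sum_(j < N) L2_sqnorm L (U j))%E.

(* The square of the H^2(G) norm.  Weak derivatives being unique almost
   everywhere, the set below is a singleton if U is in H^2(G), and it is empty
   otherwise, in which case the value is +oo. *)
Definition H2G_sqnorm U : \bar R :=
  ereal_inf [set r | exists U1 U2 : gfun R N,
    (forall j, H2_derivs L (U j) (U1 j) (U2 j)) /\
    r = (L2G_sqnorm U + L2G_sqnorm U1 + L2G_sqnorm U2)%E].

Definition continuous_at_vertex U : Prop := forall i j, U i L = U j L.

(* The graph of the operator: U is in the domain and V = - U''. *)
Definition deltap_graph Z U V : Prop :=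
  exists U1 : gfun R N,
    [/\ forall j, H2_derivs L (U j) (U1 j) (fun x => - V j x),
        forall i j, U1 i L = U1 j L &
        forall i, \sum_(j < N) U j L = Z%:C * U1 i L].

Definition deltap_dom Z : set (gfun R N) := [set U | exists V, deltap_graph Z U V].

(* gamma' s is the derivative at s of the curve gamma, for the norm whose square
   is sqnorm. *)
Definition curve_derivative (sqnorm : gfun R N -> \bar R)
    (gamma gamma' : R -> gfun R N) (s : R) : Prop :=
  sqnorm (fun j x => (h^-1)%:C * (gamma (s + h) j x - gamma s j x) - gamma' s j x)
    @[h --> 0^'] --> 0%E.

(* The curve gamma is of class C^oo on the open set I, as a map into the domain
   of the operator with its H^2(G) topology; D k is the k-th derivative. *)
Definition smooth_curve Z (I : set R) (gamma : R -> gfun R N) : Prop :=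
  exists D : nat -> R -> gfun R N,
    (forall s, I s -> D 0%N s = gamma s) /\
    (forall k s, I s ->
       deltap_dom Z (D k s) /\ curve_derivative H2G_sqnorm (D k) (D k.+1) s).

(* Equality in L^2(G) *)
Definition ae_eq_G U V : Prop :=
  forall j, {ae @lebesgue_measure R, forall x, halfline L x -> U j x = V j x}.

Definition cubic U : gfun R N := fun j x => ((normc (U j x)) ^+ 2)%:C * U j x.

Definition NLS_solution Z (U : R -> gfun R N) : Prop :=
  exists Ut HU : R -> gfun R N, forall t,
    [/\ deltap_graph Z (U t) (HU t),
        forall j, L2 L (Ut t j),
        curve_derivative L2G_sqnorm U Ut t &
        ae_eq_G (fun j x => 'i * Ut t j x - HU t j x + cubic (U t) j x)
                (fun _ _ => 0)].

Definition expi (theta : R) : R[i] := cos theta +i* sin theta.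

Definition rotate (theta : R) U : gfun R N := fun j x => expi theta * U j x.

Definition standing_wave Z omega U : Prop :=
  deltap_dom Z U /\ NLS_solution Z (fun t => rotate (omega * t) U).

Definition stationary_solution Z omega U : Prop :=
  exists HU, deltap_graph Z U HU /\
    ae_eq_G (fun j x => HU j x + omega%:C * U j x - cubic U j x) (fun _ _ => 0).

End star_graph.

Section profiles.
Context {R : realType}.

Definition sech (x : R) : R := 2 / (expR x + expR (- x)).

Definition artanh (x : R) : R := ln ((1 + x) / (1 - x)) / 2.

Definition a_star : R := artanh (1 / Num.sqrt 2).

Definition typeA (a : R) : Prop := 0 < a < a_star.

Definition typeB (a : R) : Prop := a_star < a.

Definition Psi (L omega a x : R) : R :=
  Num.sqrt (2 * omega) * sech (Num.sqrt omega * (x - L) + a).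

Definition Theta (L : R) (N n : nat) (omega a1 aN : R) : gfun R N :=
  fun j x => (Psi L omega (if (j < n)%N then a1 else aN) x)%:C.

Definition omega_star (Z : R) (N n : nat) : R :=
  (n%:R `^ (2 / 3) + (N - n)%:R `^ (2 / 3)) ^+ 3 / Z ^+ 2.

Definition omega_hat (Z : R) (N : nat) : R := 2 * N%:R ^+ 2 / Z ^+ 2.

End profiles.

Arguments Theta {R} L N n omega a1 aN.

(* Main.v *)
(* With s = sinh a1, the equality of the derivatives at the vertex forces
   sinh aN = 1 / s unless the two shifts coincide, and the remaining vertex
   condition becomes h(s) = Z^2 omega with h(s) = (1 + s^2) (n / s + N - n)^2.  The
   function h is strictly decreasing on (0, s0], where (N - n) s0^3 = n and h(s0) =
   Z^2 omega_n^*, so every omega > omega_n^* has exactly one solution in (0, s0),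
   smooth in omega by the inverse function theorem.  A shift is of type A iff its
   hyperbolic sine is less than 1; if 2n <= N then s0 <= 1, and if 2n > N then
   s = 1 exactly at h(1) = 2 N^2, that is at omega = 2 N^2 / Z^2.  The smoothness of
   the curve in H^2 follows from a Taylor bound for the difference quotients, as all
   the derivatives in omega and x decay exponentially, locally uniformly in
   omega. *)

Require Import Defs.
From mathcomp Require Import all_boot all_order all_algebra.
From mathcomp Require Import all_classical all_reals all_analysis.
From mathcomp Require Import measurable_realfun complex ring lra zify.

Set Implicit Arguments.
Unset Strict Implicit.
Unset Printing Implicit Defensive.

Import Order.TTheory GRing.Theory Num.Theory.
Import numFieldNormedType.Exports.
Import Normc.

Local Open Scope classical_set_scope.
Local Open Scope ring_scope.

(** * Exponentially decaying functions on a half-line *)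

Section halfline_integrals.
Context {R : realType}.
Variable L : R.
Implicit Types (u v f g phi : R -> R) (C k : R).

(** [smooth_curve] asks for a single sequence of derivatives of every order in the frequency, each
    in the domain of the operator and each differentiable in the H^2 norm. Explicit formulas for
    them are out of reach, so they are generated by an operation on a class of functions. The class
    must be stable under both partial derivatives: the H^2 norm of a difference quotient in the
    frequency involves its first two x-derivatives, and these are again difference quotients of the
    x-derivatives. Decay has to be built into the class with constants uniform in the frequency,
    because the intermediate points in the Taylor bound depend on x. The class is generated by
    finitely many functions because the two shifts depend on one unknown only. The derivative of a
    profile at the vertex contains sech a * tanh a = s / (1 + s^2) with s = sinh a, which is
    invariant under s -> 1/s; and the remaining unknown s has a derivative in the frequency that is
    rational in s. *)

Lemma is_derive_continuous f (df : R -> R) :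
  (forall x : R, is_derive x 1 f (df x)) -> continuous f.
Proof.
move=> Hf x; apply/differentiable_continuous; rewrite -derivable1_diffP.
by have [] := Hf x.
Qed.

Lemma integral_expR_sqr C k : 0 < k ->
  (\int[lebesgue_measure]_(x in halfline L)
     ((C * expR (- (k * (x - L)))) ^+ 2)%:E = (C ^+ 2 / (2 * k))%:E)%E.
Proof.
move=> k0.
pose F x := - (C ^+ 2 / (2 * k)) * expR (- (k * (x - L))) ^+ 2.
have dF (x : R) : is_derive x 1 F ((C * expR (- (k * (x - L)))) ^+ 2).
  rewrite /F; apply: is_derive_eq.
  rewrite /GRing.scale /= !(mulr1, subr0, scaler0, addr0, add0r).
  by field; rewrite gt_eqF.
have cf : continuous (fun x : R => (C * expR (- (k * (x - L)))) ^+ 2).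
  apply: (@is_derive_continuous _
    (fun x => 2 * (C * expR (- (k * (x - L)))) * (C * (expR (- (k * (x - L))) * - k)))).
  move=> x; apply: is_derive_eq.
  rewrite /GRing.scale /= !(mulr1, subr0, scaler0, addr0, add0r).
  by ring.
rewrite /halfline (@ge0_continuous_FTC2y R _ F L 0).
- by rewrite -EFinB /F subrr mulr0 oppr0 expR0 expr1n mulr1 sub0r opprK.
- by move=> x _; rewrite sqr_ge0.
- exact: continuous_subspaceT.
- rewrite /F -[X in _ --> X](mulr0 (- (C ^+ 2 / (2 * k)))).
  apply: cvgMr.
  rewrite -[X in _ --> X](expr0n R 2) /=.
  apply: (cvg_comp _ (fun y : R => y ^+ 2)); last exact: exprn_continuous.
  apply/cvgrPdist_le => e e0.
  have /cvgrPdist_le/(_ e e0)[M [_ HM]] := @cvgr_expR R.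
  exists (M / k + L); split; first exact: num_real.
  move=> x Hx; apply: (HM (k * (x - L))).
  by rewrite mulrC -ltr_pdivrMr// ltrBrDr.
- by move=> x _; have [] := dF x.
- by apply: cvg_at_right_filter; apply: is_derive_continuous dF L.
- by move=> x _; rewrite derive1E; apply: derive_val.
Qed.

Lemma L2_sqnorm_le u v C k : 0 < k -> continuous u -> continuous v ->
  (forall x, L <= x -> `|u x| <= C * expR (- (k * (x - L)))) ->
  (forall x, L <= x -> `|v x| <= C * expR (- (k * (x - L)))) ->
  (L2_sqnorm L (fun x => u x +i* v x)%C <= (C ^+ 2 / k)%:E)%E.
Proof.
move=> k0 cu cv Hu Hv.
(* The factor [sqrt 2] collects the two squares [u ^+ 2 + v ^+ 2] into one exponential of the form
   integrated above. *)
have -> : C ^+ 2 / k = (Num.sqrt 2 * C) ^+ 2 / (2 * k).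
  by rewrite exprMn sqr_sqrtr ?ler0n//; field; rewrite gt_eqF.
rewrite -integral_expR_sqr// /L2_sqnorm.
have hm : measurable (halfline L) by exact: measurable_itv.
have n2 x : normc (u x +i* v x)%C ^+ 2 = u x ^+ 2 + v x ^+ 2.
  by rewrite /= sqr_sqrtr// addr_ge0 ?sqr_ge0.
under eq_integral do rewrite n2.
apply: ge0_le_integral => //.
- by move=> x _; rewrite lee_fin addr_ge0 ?sqr_ge0.
- apply/measurable_EFinP; apply: measurable_funTS; apply: continuous_measurable_fun.
  move=> x; apply: cvgD; apply: (cvg_comp _ (fun y : R => y ^+ 2));
    by [exact: cu|exact: cv|exact: exprn_continuous].
- apply/measurable_EFinP; apply: measurable_funTS; apply: continuous_measurable_fun.
  apply: (@is_derive_continuous _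
    (fun x => 2 * (Num.sqrt 2 * C * expR (- (k * (x - L)))) *
              (Num.sqrt 2 * C * (expR (- (k * (x - L))) * - k)))).
  move=> x; apply: is_derive_eq.
  rewrite /GRing.scale /= !(mulr1, subr0, scaler0, addr0, add0r).
  by ring.
- move=> x; rewrite /halfline /= in_itv /= andbT => Lx.
  rewrite lee_fin -mulrA exprMn sqr_sqrtr ?ler0n//.
  rewrite -(real_normK (num_real (u x))) -(real_normK (num_real (v x))).
  have sq a b : 0 <= a -> a <= b -> a ^+ 2 <= b ^+ 2 :> R.
    by move=> a0 ab; rewrite ler_sqr// nnegrE (le_trans a0).
  rewrite mulr_natl mulr2n; apply: lerD; apply: sq => //; [exact: Hu|exact: Hv].
Qed.

Lemma L2_sqnorm_ge0 (f : R -> R[i]) : (0 <= L2_sqnorm L f)%E.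
Proof. by apply: integral_ge0 => x _; rewrite lee_fin sqr_ge0. Qed.

Definition exp_decay u :=
  exists C k, 0 < k /\ forall x, L <= x -> `|u x| <= C * expR (- (k * (x - L))).

Lemma expR_decay_le C C' k k' (x : R) : L <= x -> C <= C' -> 0 <= C' -> k' <= k ->
  C * expR (- (k * (x - L))) <= C' * expR (- (k' * (x - L))).
Proof.
move=> Lx CC C0 kk; apply: (@le_trans _ _ (C' * expR (- (k * (x - L))))).
  by rewrite ler_wpM2r// expR_ge0.
by rewrite ler_wpM2l// ler_expR lerN2 ler_wpM2r// subr_ge0.
Qed.

Lemma exp_decay2 u v : exp_decay u -> exp_decay v -> exists C k, [/\ 0 < k,
  forall x, L <= x -> `|u x| <= C * expR (- (k * (x - L))) &
  forall x, L <= x -> `|v x| <= C * expR (- (k * (x - L)))].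
Proof.
move=> [C1 [k1 [k10 H1]]] [C2 [k2 [k20 H2]]].
(* [exp_decay] does not record the sign of its constant; absolute values make the common one
   nonnegative, as [expR_decay_le] requires. *)
exists (Num.max `|C1| `|C2|), (Num.min k1 k2); split; first by rewrite lt_min k10.
  move=> x Lx; apply: le_trans (H1 x Lx) _; apply: expR_decay_le => //.
  - by rewrite le_max ler_norm.
  - by rewrite ge_min lexx.
move=> x Lx; apply: le_trans (H2 x Lx) _; apply: expR_decay_le => //.
- by rewrite le_max ler_norm orbT.
- by rewrite ge_min lexx orbT.
Qed.

Lemma exp_decayD u v : exp_decay u -> exp_decay v -> exp_decay (fun x => u x + v x).
Proof.
move=> hu hv; have [C [k [k0 Hu Hv]]] := exp_decay2 hu hv.
exists (C + C), k; split=> // x Lx.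
by rewrite (le_trans (ler_normD _ _))// mulrDl lerD ?Hu ?Hv.
Qed.

Lemma exp_decayZ (c : R) u : exp_decay u -> exp_decay (fun x => c * u x).
Proof.
move=> [C [k [k0 Hu]]]; exists (`|c| * C), k; split=> // x Lx.
by rewrite normrM -mulrA ler_wpM2l// Hu.
Qed.

Lemma L2_exp_decay u v : continuous u -> continuous v -> exp_decay u -> exp_decay v ->
  L2 L (fun x => u x +i* v x)%C.
Proof.
move=> cu cv hu hv; split.
- by apply: measurable_funTS; exact: continuous_measurable_fun.
- by apply: measurable_funTS; exact: continuous_measurable_fun.
- have [C [k [k0 Hu Hv]]] := exp_decay2 hu hv.
  by apply: le_lt_trans (L2_sqnorm_le k0 cu cv Hu Hv) _; rewrite ltry.
Qed.

Lemma Rintegral_halfline_supp f (b : R) : L < b -> (forall x, L <= x -> b < x -> f x = 0) ->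
  \int[lebesgue_measure]_(x in halfline L) f x =
  \int[lebesgue_measure]_(x in `[L, b]) f x.
Proof.
move=> Lb f0; rewrite [LHS]Rintegral_mkcond [RHS]Rintegral_mkcond.
apply: eq_Rintegral => x _; rewrite !patchE /halfline.
rewrite !mem_setE !in_itv /= andbT.
case: (leP L x) => //= Lx; case: (leP x b) => //= bx.
by rewrite f0.
Qed.

Lemma integral_by_parts_test f f' phi :
  (forall x : R, is_derive x 1 f (f' x)) -> continuous f' -> test_function L phi ->
  \int[lebesgue_measure]_(x in halfline L) (f x * derive1 phi x) =
  - \int[lebesgue_measure]_(x in halfline L) (f' x * phi x).
Proof.
move=> df cf' [smooth_phi [a [b [La supp]]]].
have dphi (x : R) : is_derive x 1 phi (derive1 phi x).
  by rewrite derive1E; apply/derivableP; exact: (smooth_phi 0%N).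
have cdphi : continuous (derive1 phi).
  move=> x; apply/differentiable_continuous; rewrite -derivable1_diffP.
  exact: (smooth_phi 1%N).
(* The bound [b] may lie below [L], hence the maximum; the added 1 puts [c] strictly beyond the
   support, so that both boundary terms vanish. *)
pose c := Num.max L b + 1.
have Lc : L < c by rewrite ltr_pwDr// le_max lexx.
have phi0 x : x < a \/ b < x -> phi x = 0.
  move=> H; apply/eqP/negPn/negP => /supp /andP[ax xb].
  by case: H; [rewrite ltNge ax|rewrite ltNge xb].
have bc x : c < x -> b < x.
  by move=> cx; apply: le_lt_trans cx; rewrite /c ler_wpDr// le_max lexx orbT.
have dphi0 x : c < x -> derive1 phi x = 0.
  move=> cx; rewrite derive1E.
  apply: derive_val; apply: (@near_eq_is_derive _ _ _ (cst 0)).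
  near=> y; rewrite phi0//=; right; apply: bc; near: y.
  exact: lt_nbhsr.
rewrite (@Rintegral_halfline_supp _ c)//; last by move=> x _ cx; rewrite dphi0// mulr0.
rewrite (@Rintegral_halfline_supp _ c)//; last first.
  by move=> x _ cx; rewrite phi0 ?mulr0//; right; exact: bc.
have dLR g g' : (forall x : R, is_derive x 1 g (g' x)) -> derivable_oo_LRcontinuous g L c.
  move=> dg; have cg := is_derive_continuous dg; split.
  - by move=> x _; have [] := dg x.
  - by apply: cvg_at_right_filter; exact: cg.
  - by apply: cvg_at_left_filter; exact: cg.
rewrite (@Rintegration_by_parts R f phi f' (derive1 phi) L c)//.
- rewrite [phi L]phi0; last by left.
  by rewrite [phi c]phi0 ?mulr0 ?subrr ?sub0r//; right; rewrite /c ltr_pwDr// le_max lexx orbT.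
- exact: continuous_subspaceT.
- exact: dLR df.
- by move=> x _; rewrite derive1E; apply: derive_val.
- exact: continuous_subspaceT.
- exact: dLR dphi.
Unshelve. all: by end_near.
Qed.

Lemma weak_derivative_C1 u v u' v' :
  (forall x : R, is_derive x 1 u (u' x)) -> continuous u' ->
  (forall x : R, is_derive x 1 v (v' x)) -> continuous v' ->
  weak_derivative L (fun x => u x +i* v x)%C (fun x => u' x +i* v' x)%C.
Proof.
move=> du cu' dv cv' phi hphi; rewrite /cintegral.
have E (a b c : R) : ((a +i* b) * (c%:C) = (a * c) +i* (b * c))%C.
  by rewrite /GRing.mul /=; rewrite !mulr0 subr0 add0r.
under eq_Rintegral do rewrite E /=.
under [X in (_ +i* X)%C = _]eq_Rintegral do rewrite E /=.
under [X in _ = (- (X +i* _))%C]eq_Rintegral do rewrite E /=.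
under [X in _ = (- (_ +i* X))%C]eq_Rintegral do rewrite E /=.
by rewrite (integral_by_parts_test du)// (integral_by_parts_test dv).
Qed.

(** The profiles extend smoothly across the vertex to the whole line. Regularity is therefore taken
    on the line, which avoids one-sided derivatives at [L], while decay concerns [x >= L] only. *)
Lemma H2_derivs_C2 u u1 u2 v v1 v2 :
  (forall x : R, is_derive x 1 u (u1 x)) -> (forall x : R, is_derive x 1 u1 (u2 x)) ->
  (forall x : R, is_derive x 1 v (v1 x)) -> (forall x : R, is_derive x 1 v1 (v2 x)) ->
  continuous u2 -> continuous v2 ->
  [/\ exp_decay u, exp_decay u1 & exp_decay u2] ->
  [/\ exp_decay v, exp_decay v1 & exp_decay v2] ->
  H2_derivs L (fun x => u x +i* v x)%C (fun x => u1 x +i* v1 x)%C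
    (fun x => u2 x +i* v2 x)%C.
Proof.
move=> du du1 dv dv1 cu2 cv2 [hu hu1 hu2] [hv hv1 hv2].
have [cu cu1] := (is_derive_continuous du, is_derive_continuous du1).
have [cv cv1] := (is_derive_continuous dv, is_derive_continuous dv1).
split; [exact: L2_exp_decay.. | exact: weak_derivative_C1 | exact: weak_derivative_C1 | |].
  by split; exact: continuous_subspaceT.
by split; exact: continuous_subspaceT.
Qed.

End halfline_integrals.

(** * Differentiation along curves *)

Section taylor.
Context {R : realType}.
Implicit Types f : R -> R.

(** Difference quotients have increments of both signs, hence a mean value theorem that does not
    order its endpoints. *)
Lemma MVT_sym f (f' : R -> R) (a b : R) :
  (forall x : R, Num.min a b <= x <= Num.max a b -> is_derive x 1 f (f' x)) ->
  exists2 c, Num.min a b <= c <= Num.max a b & f b - f a = f' c * (b - a).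
Proof.
wlog ab : a b / a <= b.
  move=> H; case/orP: (le_total a b) => [ab|ba] df.
    by apply: H => // x; rewrite min_l// max_r//; exact: df.
  have [|c cab E] := H b a ba; last first.
    exists c; first by rewrite minC maxC.
    by rewrite -opprB E; ring.
  by move=> x xba; apply: df; rewrite minC maxC.
rewrite min_l// max_r// => df.
have [||c] := @MVT_segment R f f' a b ab.
- by move=> x; rewrite in_itv => /andP[ax xb]; apply: df; rewrite !ltW.
- apply: derivable_within_continuous => x; rewrite in_itv => /= xab.
  by have [] := df x xab.
- by rewrite in_itv => cab E; exists c.
Qed.

(** Two mean value steps: the quotient equals [f' c], and [f' c - f' s] equals [f'' c' * (c - s)].
    The factor 1/2 of the sharp bound is given up. *)
Lemma taylor1_le f (f' f'' : R -> R) (s h M : R) : h != 0 ->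
  (forall w : R, `|w - s| <= `|h| -> [/\ is_derive w 1 f (f' w),
     is_derive w 1 f' (f'' w) & `|f'' w| <= M]) ->
  `|h^-1 * (f (s + h) - f s) - f' s| <= `|h| * M.
Proof.
move=> h0 H.
have near_s a w : `|a - s| <= `|h| -> Num.min s a <= w <= Num.max s a ->
    `|w - s| <= `|h|.
  move=> ash; case: (leP s a) => [sa|/ltW sa] /andP[w1 w2].
    apply: le_trans ash; rewrite !ger0_norm ?subr_ge0// ?lerD2r//.
  apply: le_trans ash; rewrite !ler0_norm ?subr_le0// ?lerN2 ?lerD2r//.
have shs : `|s + h - s| <= `|h| by rewrite addrC addKr.
have [|c cI ->] := @MVT_sym f f' s (s + h).
  by move=> x /(near_s _ _ shs) /H[].
have cs := near_s _ _ shs cI.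
rewrite (_ : h^-1 * (f' c * (s + h - s)) = f' c); last by field.
have [|c' c'I ->] := @MVT_sym f' f'' s c.
  by move=> x /(near_s _ _ cs) /H[].
have [_ _ Hc'] := H _ (near_s _ _ cs c'I).
by rewrite normrM mulrC ler_pM.
Qed.

End taylor.

Section curves.
Context {R : realType}.
Variable L : R.
Implicit Types (F G : R -> R -> R) (s : R).

(** One pair of constants serves all [w] near [s]: the intermediate points of the Taylor bound vary
    with [x]. *)
Definition locally_decaying F (s : R) := exists C k, 0 < k /\
  \forall w \near s, forall x, L <= x -> `|F w x| <= C * expR (- (k * (x - L))).

Lemma locally_decaying_at F s : locally_decaying F s -> exp_decay L (F s).
Proof. by move=> [C [k [k0 /nbhs_singleton H]]]; exists C, k. Qed.

Definition remainder F F' (s h x : R) := h^-1 * (F (s + h) x - F s x) - F' s x.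

(** The Taylor bound at fixed [x] gives a remainder of size [|h| * M * expR (- (l * (x - L)))],
    whose squared L^2 norm is of order [h ^+ 2]. *)
Lemma L2_sqnorm_remainder F F1 F2 G G1 G2 s :
  (\forall w \near s, forall x : R, is_derive (w : R) 1 (F ^~ x) (F1 w x)) ->
  (\forall w \near s, forall x : R, is_derive (w : R) 1 (F1 ^~ x) (F2 w x)) ->
  (\forall w \near s, forall x : R, is_derive (w : R) 1 (G ^~ x) (G1 w x)) ->
  (\forall w \near s, forall x : R, is_derive (w : R) 1 (G1 ^~ x) (G2 w x)) ->
  (\forall w \near s, continuous (F w)) -> continuous (F1 s) ->
  (\forall w \near s, continuous (G w)) -> continuous (G1 s) ->
  locally_decaying F2 s -> locally_decaying G2 s ->
  L2_sqnorm L (fun x => remainder F F1 s h x +i* remainder G G1 s h x)%C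
    @[h --> 0^'] --> 0%E.
Proof.
move=> dF dF1 dG dG1 cF cF1 cG cG1 [C [k [k0 HF]]] [C' [k' [k'0 HG]]].
pose M := Num.max `|C| `|C'|; pose l := Num.min k k'.
have l0 : 0 < l by rewrite lt_min k0.
pose P w := [/\ forall x, [/\ is_derive (w : R) 1 (F ^~ x) (F1 w x),
  is_derive (w : R) 1 (F1 ^~ x) (F2 w x), is_derive (w : R) 1 (G ^~ x) (G1 w x) &
  is_derive (w : R) 1 (G1 ^~ x) (G2 w x)], continuous (F w), continuous (G w),
  forall x, L <= x -> `|F2 w x| <= M * expR (- (l * (x - L))) &
  forall x, L <= x -> `|G2 w x| <= M * expR (- (l * (x - L)))].
have : \forall w \near s, P w.
  near=> w; split.
  - move=> x; split; move: x; near: w; assumption.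
  - by near: w.
  - by near: w.
  - move=> x Lx; apply: (@le_trans _ _ (C * expR (- (k * (x - L))))).
      by move: x Lx; near: w.
    by apply: expR_decay_le => //; rewrite /M /l ?ge_min ?le_max ?ler_norm ?normr_ge0 ?lexx.
  - move=> x Lx; apply: (@le_trans _ _ (C' * expR (- (k' * (x - L))))).
      by move: x Lx; near: w.
    by apply: expR_decay_le => //;
      rewrite /M /l ?ge_min ?le_max ?ler_norm ?normr_ge0 ?lexx ?orbT.
(* A ball is extracted because [taylor1_le] needs its hypotheses at every point within [|h|] of
   [s]. *)
move=> /nbhs_ballP[d /= d0 HP].
have {}HP w : `|w - s| < d -> P w by move=> wd; apply: HP; rewrite /ball /= distrC.
apply: (@squeeze_cvge _ _ _ _ (cst 0%E) _ (fun h => ((`|h| * M) ^+ 2 / l)%:E)).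
- near=> h; rewrite L2_sqnorm_ge0 /=.
  have h0 : h != 0 by near: h; exact: nbhs_dnbhs_neq.
  have hd : `|h| < d by near: h; exact: dnbhs0_lt.
  have [_ cFh cGh _ _] : P (s + h) by apply: HP; rewrite addrC addKr.
  have [_ cFs cGs _ _] : P s by apply: HP; rewrite subrr normr0.
  apply: L2_sqnorm_le => //.
  + move=> x; apply: cvgB; last exact: cF1.
    by apply: cvgMr; apply: cvgB; [exact: cFh|exact: cFs].
  + move=> x; apply: cvgB; last exact: cG1.
    by apply: cvgMr; apply: cvgB; [exact: cGh|exact: cGs].
  + move=> x Lx; rewrite -mulrA.
    apply: (@taylor1_le _ (F ^~ x) (F1 ^~ x) (F2 ^~ x)) => // w wh.
    have [/(_ x) [d1 d2 _ _] _ _ /(_ x Lx) bd _] := HP w (le_lt_trans wh hd).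
    by split.
  + move=> x Lx; rewrite -mulrA.
    apply: (@taylor1_le _ (G ^~ x) (G1 ^~ x) (G2 ^~ x)) => // w wh.
    have [/(_ x) [_ _ d1 d2] _ _ _ /(_ x Lx) bd] := HP w (le_lt_trans wh hd).
    by split.
- exact: cvg_cst.
- apply/fine_cvgP; split; first by near=> h.
  have hM : `|h : R| * M @[h --> 0^'] --> `|0 : R| * M.
    by apply: cvgMl; apply: cvg_norm; exact: nbhs_dnbhs.
  have : (`|h : R| * M) ^+ 2 / l @[h --> 0^'] --> (`|0 : R| * M) ^+ 2 / l.
    by apply: cvgMl; exact: (cvg_comp _ _ hM (@exprn_continuous R 2 _)).
  by rewrite normr0 mul0r expr0n mul0r.
Unshelve. all: by end_near.
Qed.

End curves.

(** * Membership in the domain, from real and imaginary parts *)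

Section vertex_conditions.
Context {R : realType}.
Variables (L Z : R) (N : nat).

Lemma complex_sum (a b : 'I_N -> R) :
  \sum_(j < N) (a j +i* b j)%C = ((\sum_(j < N) a j) +i* (\sum_(j < N) b j))%C.
Proof. by elim/big_rec3: _ => // j x y z _ ->. Qed.

Lemma complex_remainder (h a b a' b' c d : R) :
  (h^-1)%:C%C * ((a +i* b)%C - (a' +i* b')%C) - (c +i* d)%C =
  ((h^-1 * (a - a') - c) +i* (h^-1 * (b - b') - d))%C.
Proof. by simpc. Qed.

Lemma deltap_graph_C2 (u u1 u2 v v1 v2 : 'I_N -> R -> R) :
  (forall j (x : R), is_derive x 1 (u j) (u1 j x)) ->
  (forall j (x : R), is_derive x 1 (u1 j) (u2 j x)) ->
  (forall j (x : R), is_derive x 1 (v j) (v1 j x)) ->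
  (forall j (x : R), is_derive x 1 (v1 j) (v2 j x)) ->
  (forall j, continuous (u2 j)) -> (forall j, continuous (v2 j)) ->
  (forall j, [/\ exp_decay L (u j), exp_decay L (u1 j) & exp_decay L (u2 j)]) ->
  (forall j, [/\ exp_decay L (v j), exp_decay L (v1 j) & exp_decay L (v2 j)]) ->
  (forall i j, u1 i L = u1 j L /\ v1 i L = v1 j L) ->
  (forall i, \sum_(j < N) u j L = Z * u1 i L /\ \sum_(j < N) v j L = Z * v1 i L) ->
  deltap_graph L Z (fun j x => u j x +i* v j x)%C (fun j x => - (u2 j x +i* v2 j x)%C).
Proof.
move=> du du1 dv dv1 cu2 cv2 hu hv H1 H2.
exists (fun j x => u1 j x +i* v1 j x)%C; split.
- move=> j; rewrite [X in H2_derivs _ _ _ X](_ : _ = fun x => (u2 j x +i* v2 j x)%C).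
    exact: H2_derivs_C2.
  by apply/funext => x; rewrite opprK.
- by move=> i j; have [-> ->] := H1 i j.
- move=> i; rewrite complex_sum; have [-> ->] := H2 i.
  by rewrite /GRing.mul /= !mul0r subr0 addr0.
Qed.

End vertex_conditions.

(** * Smooth curves from families closed under differentiation *)

Section smooth_families.
Context {R : realType}.
Variables (L Z : R) (N : nat) (I : set R).
Variables (E : Type) (ev : E -> R -> R -> R) (ds dx : E -> E).
Implicit Types (e : E) (u v : 'I_N -> E) (s x : R).

Hypothesis open_I : open I.
Hypothesis derive_s : forall e s x, I s -> is_derive s 1 (ev e ^~ x) (ev (ds e) s x).
Hypothesis derive_x : forall e s x, I s -> is_derive x 1 (ev e s) (ev (dx e) s x).
Hypothesis dxs : forall e s x, I s -> ev (dx (ds e)) s x = ev (ds (dx e)) s x.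
Hypothesis decay : forall e s, I s -> locally_decaying L (ev e) s.

(** Elements of [E] name real functions of [(s, x)], and [ds], [dx] act on names, so that iterating
    [ds] supplies the derivatives of all orders. The two operations need to commute only after
    evaluation. *)
Definition family u v s : gfun R N := fun j x => (ev (u j) s x +i* ev (v j) s x)%C.

Definition vertex_condition u := forall s, I s -> forall i,
  (forall j, ev (dx (u i)) s L = ev (dx (u j)) s L) /\
  \sum_(j < N) ev (u j) s L = Z * ev (dx (u i)) s L.

Lemma near_I s : I s -> \forall w \near s, I w.
Proof. by move=> Is; exact: open_nbhs_nbhs. Qed.

Lemma continuous_ev e s : I s -> continuous (ev e s).
Proof. by move=> Is; exact: (is_derive_continuous (fun x => derive_x e x Is)). Qed.

Lemma deltap_graph_family u v s : I s -> vertex_condition u -> vertex_condition v ->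
  deltap_graph L Z (family u v s) (fun j x => - family (dx \o dx \o u) (dx \o dx \o v) s j x).
Proof.
move=> Is hu hv.
apply: (@deltap_graph_C2 _ L Z N (fun j => ev (u j) s) (fun j => ev (dx (u j)) s)
  (fun j => ev (dx (dx (u j))) s) (fun j => ev (v j) s) (fun j => ev (dx (v j)) s)
  (fun j => ev (dx (dx (v j))) s)); try by [move=> *; exact: derive_x].
- by move=> j; exact: continuous_ev.
- by move=> j; exact: continuous_ev.
- by move=> j; split; exact: locally_decaying_at (decay _ Is).
- by move=> j; split; exact: locally_decaying_at (decay _ Is).
- move=> i j; have [/(_ j) -> _] := hu s Is i.
  by have [/(_ j) -> _] := hv s Is i.
- by move=> i; have [[_ ->] [_ ->]] := (hu s Is i, hv s Is i).
Qed.

(* The vertex conditions are linear with coefficients independent of s, and the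
   two partial derivatives commute. *)
Lemma vertex_condition_ds u : vertex_condition u -> vertex_condition (ds \o u).
Proof.
move=> hu s Is i; split=> [j|] /=.
  rewrite !dxs//; have di := derive_s (dx (u i)) L Is; have dj := derive_s (dx (u j)) L Is.
  rewrite -(@derive_val _ _ _ _ _ _ _ di) -(@derive_val _ _ _ _ _ _ _ dj).
  apply: near_eq_derive; near=> w; have [|+ _] := hu w _ i; last by apply.
  by near: w; exact: near_I.
have d1 : is_derive s 1 (\sum_(j < N) (ev (u j) ^~ L)) (\sum_(j < N) ev (ds (u j)) s L).
  by apply: is_derive_sum => j; exact: derive_s.
have d2 : is_derive s 1 (Z \*: (ev (dx (u i)) ^~ L)) (Z *: ev (ds (dx (u i))) s L).
  by apply: is_deriveZ; exact: derive_s.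
rewrite dxs//; rewrite -(@derive_val _ _ _ _ _ _ _ d1) -[RHS](@derive_val _ _ _ _ _ _ _ d2).
apply: near_eq_derive; near=> w; rewrite fct_sumE; have [|_ ->//] := hu w _ i.
by near: w; exact: near_I.
Unshelve. all: by end_near.
Qed.

(** By [dxs], differentiating a remainder in [x] gives the remainder of the x-derivative. The H^2
    norm is thus controlled by three L^2 norms of remainders, each covered by
    [L2_sqnorm_remainder]. *)
Lemma H2_curve_derivative_family u v s : I s ->
  curve_derivative (@H2G_sqnorm R L N) (family u v) (family (ds \o u) (ds \o v)) s.
Proof.
move=> Is.
pose rem e h x := remainder (ev e) (ev (ds e)) s h x.
pose fam u v h : gfun R N := fun j x => (rem (u j) h x +i* rem (v j) h x)%C.
have cvg_fam u' v' : L2G_sqnorm L (fam u' v' h) @[h --> 0^'] --> 0%E.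
  have -> : (0%E : \bar R) = (\sum_(j < N) 0%E)%E by rewrite big1.
  apply: cvg_nnesum => [j _|j _]; first by near=> h; exact: L2_sqnorm_ge0.
  have nds e : \forall w \near s, forall x : R,
      is_derive (w : R) 1 (ev e ^~ x) (ev (ds e) w x).
    near=> w => x; apply: derive_s; near: w; exact: near_I.
  have ncont e : \forall w \near s, continuous (ev e w).
    by near=> w; apply: continuous_ev; near: w; exact: near_I.
  apply: L2_sqnorm_remainder; [exact: nds|exact: nds|exact: nds|exact: nds|
    exact: ncont|exact: continuous_ev|exact: ncont|exact: continuous_ev|
    exact: decay|exact: decay].
pose bound h := (L2G_sqnorm L (fam u v h) + L2G_sqnorm L (fam (dx \o u) (dx \o v) h) +
   L2G_sqnorm L (fam (dx \o dx \o u) (dx \o dx \o v) h))%E.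
have bound_cvg : bound h @[h --> 0^'] --> 0%E.
  have -> : (0%E : \bar R) = (0%E + 0%E + 0%E)%E by rewrite !adde0.
  by apply: cvgeD => //; apply: cvgeD.
have near_Ish : \forall h \near 0^', I (s + h).
  have /nbhs_ballP[d /= d0 Hd] := near_I Is; near=> h; apply: Hd.
  by rewrite /ball /= opprD addNKr normrN; near: h; exact: dnbhs0_lt.
apply: (@squeeze_cvge _ _ _ _ (cst 0%E) _ bound _ _ (@cvg_cst _ _ _ _ _) bound_cvg).
near=> h; apply/andP; split.
  apply/ereal_infP => _ [U1 [U2 [_ ->]]].
  by rewrite !adde_ge0// sume_ge0// => j _; exact: L2_sqnorm_ge0.
have Ish : I (s + h) by near: h.
(* The norm is an infimum over pairs of weak derivatives, so exhibiting one pair bounds it from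
   above. *)
apply: ereal_inf_lbound; exists (fam (dx \o u) (dx \o v) h),
  (fam (dx \o dx \o u) (dx \o dx \o v) h); split; last first.
  congr (L2G_sqnorm L _ + _ + _)%E; apply/funext => j; apply/funext => x.
  exact/esym/complex_remainder.
move=> j.
have drem e x : is_derive x 1 (rem e h) (rem (dx e) h x).
  have d1 := derive_x e x Ish; have d2 := derive_x e x Is.
  have d3 := derive_x (ds e) x Is.
  rewrite /rem /remainder -dxs//.
  by apply: is_deriveB; apply: is_deriveZ; apply: is_deriveB.
have crem e : continuous (rem e h) by apply: is_derive_continuous; exact: drem.
have decrem e : exp_decay L (rem e h).
  apply: exp_decayD; first apply: exp_decayZ; first apply: exp_decayD.
  - exact: locally_decaying_at (decay _ Ish).
  - under eq_fun do rewrite -mulN1r.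
    by apply: exp_decayZ; exact: locally_decaying_at (decay _ Is).
  - under eq_fun do rewrite -mulN1r.
    by apply: exp_decayZ; exact: locally_decaying_at (decay _ Is).
rewrite [X in H2_derivs _ X](_ : _ = fam u v h j); first exact: H2_derivs_C2.
by apply/funext => x; exact: complex_remainder.
Unshelve. all: by end_near.
Qed.

Lemma smooth_curve_family u v : vertex_condition u -> vertex_condition v ->
  smooth_curve L Z I (family u v).
Proof.
move=> hu hv.
have iter_ds w k : vertex_condition w -> vertex_condition (iter k ds \o w).
  by move=> hw; elim: k => // k; exact: vertex_condition_ds.
exists (fun k => family (iter k ds \o u) (iter k ds \o v)); split=> // k s Is; split.
  by eexists; apply: deltap_graph_family => //; exact: iter_ds.
exact: H2_curve_derivative_family.
Qed.

End smooth_families.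

(** * Profiles and their derivatives *)

Section hyperbolic.
Context {R : realType}.
Implicit Types x y : R.

Definition tanh x : R := (expR x - expR (- x)) / (expR x + expR (- x)).

Definition arsinh x : R := ln (x + Num.sqrt (1 + x ^+ 2)).

Lemma cosh2_gt0 x : 0 < expR x + expR (- x).
Proof. by rewrite addr_gt0 ?expR_gt0. Qed.

Lemma is_derive_sech x : is_derive x 1 (@sech R) (- sech x * tanh x).
Proof.
rewrite /sech; have c0 : expR x + expR (- x) != 0 by rewrite gt_eqF ?cosh2_gt0.
apply: is_derive_eq; rewrite /GRing.scale /= /tanh /sech.
by field.
Qed.

Lemma is_derive_tanh x : is_derive x 1 tanh (sech x ^+ 2).
Proof.
rewrite /tanh; have c0 : expR x + expR (- x) != 0 by rewrite gt_eqF ?cosh2_gt0.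
apply: is_derive_eq; rewrite /GRing.scale /= /sech.
have eN : expR x * expR (- x) = 1 by rewrite -expRD subrr expR0.
have <- : expR x * expR (- x) * 4 / (expR x + expR (- x)) ^+ 2 =
  (2 / (expR x + expR (- x))) ^+ 2 by rewrite eN; field.
by field.
Qed.

Lemma sech_gt0 x : 0 < sech x.
Proof. by rewrite /sech divr_gt0 ?cosh2_gt0. Qed.

Lemma sech_le_expR x : sech x <= 2 * expR (- x).
Proof.
have -> : 2 * expR (- x) = 2 / expR x by rewrite expRN.
rewrite /sech ler_pM2l// lef_pV2 ?posrE ?cosh2_gt0 ?expR_gt0//.
by rewrite lerDl expR_ge0.
Qed.

Lemma sech2_tanh2 x : sech x ^+ 2 + tanh x ^+ 2 = 1.
Proof.
have c0 : expR x + expR (- x) != 0 by rewrite gt_eqF ?cosh2_gt0.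
have eN : expR x * expR (- x) = 1 by rewrite -expRD subrr expR0.
have -> : sech x ^+ 2 = expR x * expR (- x) * 4 / (expR x + expR (- x)) ^+ 2.
  by rewrite eN /sech; field.
by rewrite /tanh; field.
Qed.

Lemma sech_le1 x : sech x <= 1.
Proof.
have : sech x ^+ 2 <= 1 by rewrite -(sech2_tanh2 x) lerDl sqr_ge0.
by rewrite expr_le1// ltW// sech_gt0.
Qed.

Lemma norm_tanh_le1 x : `|tanh x| <= 1.
Proof.
rewrite -(@expr_le1 _ 2)// real_normK ?num_real//.
by rewrite -(sech2_tanh2 x) lerDr sqr_ge0.
Qed.

Lemma sqrtD1sqr_gt0 x : 0 < Num.sqrt (1 + x ^+ 2).
Proof. by rewrite sqrtr_gt0 ltr_wpDr ?sqr_ge0. Qed.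

Lemma sqr_sqrtD1sqr x : Num.sqrt (1 + x ^+ 2) ^+ 2 = 1 + x ^+ 2.
Proof. by rewrite sqr_sqrtr// addr_ge0 ?sqr_ge0. Qed.

(** If two shifts have reciprocal hyperbolic sines, the cosh of one is thereby expressed through the
    cosh of the other; a single square root then serves both groups of edges. *)
Lemma sqrtD1sqrV x : 0 < x -> Num.sqrt (1 + x^-1 ^+ 2) = Num.sqrt (1 + x ^+ 2) / x.
Proof.
move=> x0; rewrite -[X in _ / X](ger0_norm (ltW x0)) -sqrtr_sqr -sqrtrV ?sqr_ge0//.
rewrite -sqrtrM ?addr_ge0 ?sqr_ge0//; congr Num.sqrt; field.
by rewrite gt_eqF.
Qed.

Lemma arsinh_arg_gt0 x : 0 < x + Num.sqrt (1 + x ^+ 2).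
Proof.
rewrite -ltrBlDl sub0r (le_lt_trans (ler_norm _))// normrN -sqrtr_sqr.
by rewrite ltr_sqrt ?ltr_pwDl// sqr_ge0.
Qed.

Lemma expR_arsinh x : expR (arsinh x) = x + Num.sqrt (1 + x ^+ 2).
Proof. by rewrite /arsinh lnK// posrE arsinh_arg_gt0. Qed.

Lemma expRN_arsinh x : expR (- arsinh x) = Num.sqrt (1 + x ^+ 2) - x.
Proof.
rewrite expRN expR_arsinh.
have x0 := arsinh_arg_gt0 x.
apply: (mulfI (lt0r_neq0 x0)); rewrite mulfV ?lt0r_neq0//.
have := sqr_sqrtD1sqr x; set q := Num.sqrt _ => qE.
by transitivity (q ^+ 2 - x ^+ 2); [rewrite qE|]; ring.
Qed.

Lemma sech_arsinh x : sech (arsinh x) = (Num.sqrt (1 + x ^+ 2))^-1.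
Proof.
have := sqrtD1sqr_gt0 x.
rewrite /sech expR_arsinh expRN_arsinh => q0; field.
by rewrite lt0r_neq0//=; apply/eqP; lra.
Qed.

Lemma tanh_arsinh x : tanh (arsinh x) = x / Num.sqrt (1 + x ^+ 2).
Proof.
have := sqrtD1sqr_gt0 x.
rewrite /tanh expR_arsinh expRN_arsinh => q0; field.
by rewrite lt0r_neq0//=; apply/eqP; lra.
Qed.

Lemma is_derive_arsinh x : is_derive x 1 arsinh (Num.sqrt (1 + x ^+ 2))^-1.
Proof.
have q0 := sqrtD1sqr_gt0 x; have p0 := arsinh_arg_gt0 x.
rewrite /arsinh.
have s0 : 0 < 1 + x ^+ 2 by rewrite ltr_wpDr ?sqr_ge0.
have d1 : is_derive x 1 (fun y => 1 + y ^+ 2) (2 * x).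
  by apply: is_derive_eq; rewrite /GRing.scale /=; ring.
have d2 := @is_derive1_comp R Num.sqrt (fun y => 1 + y ^+ 2) x _ _ (is_derive1_sqrt s0) d1.
have d3 : is_derive x 1 (fun y => y + Num.sqrt (1 + y ^+ 2))
   (1 + (2 * Num.sqrt (1 + x ^+ 2))^-1 * (2 * x)) by exact: is_deriveD.
have := @is_derive1_comp R (@ln R) (fun y => y + Num.sqrt (1 + y ^+ 2)) x _ _ (is_derive1_ln p0) d3.
rewrite /comp; move/is_derive_eq; apply.
by field; rewrite !lt0r_neq0.
Qed.

Lemma ler_arsinh : {mono arsinh : x y / x <= y}.
Proof.
apply: le_mono => x y xy; rewrite ltNge; apply/negP => yx.
(* Adding the two inequalities cancels the square roots and leaves [2 * y <= 2 * x]. *)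
have : expR (- arsinh x) <= expR (- arsinh y) by rewrite ler_expR lerN2.
have : expR (arsinh y) <= expR (arsinh x) by rewrite ler_expR.
by rewrite !expR_arsinh !expRN_arsinh; lra.
Qed.

Lemma ltr_arsinh : {mono arsinh : x y / x < y}.
Proof. exact: leW_mono ler_arsinh. Qed.

Lemma arsinh0 : arsinh 0 = 0.
Proof. by rewrite /arsinh expr0n addr0 sqrtr1 add0r ln1. Qed.

Lemma arsinh_gt0 x : (0 < arsinh x) = (0 < x).
Proof. by rewrite -{1}arsinh0 ltr_arsinh. Qed.

Lemma a_starE : a_star = arsinh 1 :> R.
Proof.
have s2 : Num.sqrt 2 ^+ 2 = 2 :> R by rewrite sqr_sqrtr.
have s0 : 1 < Num.sqrt 2 :> R by rewrite -[X in X < _]sqrtr1 ltr_sqrt ?ltr1n.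
rewrite /a_star /artanh /arsinh expr1n.
(* With [q ^+ 2 = 2] the quotient [(q + 1) / (q - 1)] is [(q + 1) ^+ 2]; the square cancels the 1/2
   in [artanh]. *)
have -> : (1 + 1 / Num.sqrt 2) / (1 - 1 / Num.sqrt 2) = (1 + Num.sqrt (1 + 1)) ^+ 2 :> R.
  move: s2 s0; set q := Num.sqrt 2 => s2 s0.
  have -> : (1 + 1 / q) / (1 - 1 / q) = (q + 1) / (q - 1).
    by field; rewrite !gt_eqF ?subr_gt0//; lra.
  have q1 : q - 1 != 0 by rewrite gt_eqF ?subr_gt0.
  apply: (mulIf q1); rewrite divfK//.
  transitivity ((1 + q) * (q ^+ 2 - 1)); last by ring.
  by rewrite s2; ring.
rewrite lnXn; last by rewrite ltr_wpDr// sqrtr_ge0.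
by rewrite -[X in X / _]mulr_natr mulfK.
Qed.

End hyperbolic.

(* A curve of profiles must be differentiated infinitely often in w with all the
   derivatives controlled in H^2.  All the functions that arise are polynomials in
   finitely many generators whose partial derivatives in w and x are again such
   polynomials; reifying them as syntax makes both partial derivatives operations
   on expressions. *)
Inductive generator :=
  GSqrt | GSqrtV | GRoot | GRootV | GRhoV | GQV | GCos | GSin | GPos
| GSech of bool | GTanh of bool.

Inductive expr (R : Type) :=
  Cst of R | Gen of generator | Add of expr R & expr R | Mul of expr R & expr R.

Arguments Gen {R}.

Section profile_algebra.
Context {R : realType}.
Variables (L Z n m t : R) (r : R -> R) (I : set R).
Implicit Types (g : generator) (e : expr R) (w x : R).

Local Notation "a |+| b" := (Add a b) (at level 50, left associativity).
Local Notation "a |*| b" := (Mul a b) (at level 40, left associativity).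

Definition shift_of (b : bool) w : R := if b then arsinh (r w) else arsinh (r w)^-1.

(* Half the derivative of y |-> (1 + y ^ 2) * (n / y + m) ^ 2. *)
Definition slope (y : R) : R := (n * y^-1 + m) * (m * y - n * y^-1 ^+ 2).

(* r w is the hyperbolic sine of the shift of the first n components at frequency
   w, and its inverse that of the others. *)
Definition eval_gen g w x : R :=
  match g with
  | GSqrt => Num.sqrt w
  | GSqrtV => (Num.sqrt w)^-1
  | GRoot => r w
  | GRootV => (r w)^-1
  | GRhoV => (Num.sqrt (1 + r w ^+ 2))^-1
  | GQV => (slope (r w))^-1
  | GCos => cos (t * w)
  | GSin => sin (t * w)
  | GPos => x - L
  | GSech b => sech (Num.sqrt w * (x - L) + shift_of b w)
  | GTanh b => tanh (Num.sqrt w * (x - L) + shift_of b w)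
  end.

Fixpoint eval e w x : R :=
  match e with
  | Cst c => c
  | Gen g => eval_gen g w x
  | Add a b => eval a w x + eval b w x
  | Mul a b => eval a w x * eval b w x
  end.

(** Implicit differentiation of [(1 + r ^+ 2) * (n / r + m) ^+ 2 = Z ^+ 2 * w], the left side having
    derivative [2 * slope r] in [r]. *)
Definition d_root : expr R := Cst (Z ^+ 2 / 2) |*| Gen GQV.

Definition d_shift (b : bool) : expr R :=
  d_root |*| Gen GRhoV |*| (if b then Cst 1 else Cst (-1) |*| Gen GRootV).

Definition d_phase b : expr R :=
  Cst (1 / 2) |*| Gen GSqrtV |*| Gen GPos |+| d_shift b.

(** Reciprocals are generators in their own right, so that every clause is a polynomial. The bracket
    in the [GQV] clause is the derivative of [slope] by the product rule. *)
Definition dw_gen g : expr R :=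
  match g with
  | GSqrt => Cst (1 / 2) |*| Gen GSqrtV
  | GSqrtV => Cst (- (1 / 2)) |*| Gen GSqrtV |*| Gen GSqrtV |*| Gen GSqrtV
  | GRoot => d_root
  | GRootV => Cst (-1) |*| d_root |*| Gen GRootV |*| Gen GRootV
  | GRhoV => Cst (-1) |*| Gen GRoot |*| d_root |*| Gen GRhoV |*| Gen GRhoV |*| Gen GRhoV
  | GQV => Cst (-1) |*| d_root |*| Gen GQV |*| Gen GQV |*|
      (Cst (- n) |*| Gen GRootV |*| Gen GRootV |*|
         (Cst m |*| Gen GRoot |+| Cst (- n) |*| Gen GRootV |*| Gen GRootV) |+|
       (Cst n |*| Gen GRootV |+| Cst m) |*|
         (Cst m |+| Cst (2 * n) |*| Gen GRootV |*| Gen GRootV |*| Gen GRootV))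
  | GCos => Cst (- t) |*| Gen GSin
  | GSin => Cst t |*| Gen GCos
  | GPos => Cst 0
  | GSech b => Cst (-1) |*| d_phase b |*| Gen (GSech b) |*| Gen (GTanh b)
  | GTanh b => d_phase b |*| Gen (GSech b) |*| Gen (GSech b)
  end.

Definition dx_gen g : expr R :=
  match g with
  | GPos => Cst 1
  | GSech b => Cst (-1) |*| Gen GSqrt |*| Gen (GSech b) |*| Gen (GTanh b)
  | GTanh b => Gen GSqrt |*| Gen (GSech b) |*| Gen (GSech b)
  | _ => Cst 0
  end.

Fixpoint derivation (d : generator -> expr R) e : expr R :=
  match e with
  | Cst c => Cst 0
  | Gen g => d g
  | Add a b => derivation d a |+| derivation d b
  | Mul a b => derivation d a |*| b |+| a |*| derivation d b
  end.

Local Notation dw := (derivation dw_gen).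
Local Notation dx := (derivation dx_gen).

Hypothesis I_gt0 : forall w, I w -> 0 < w.
Hypothesis r_gt0 : forall w, I w -> 0 < r w.
Hypothesis slope_neq0 : forall w, I w -> slope (r w) != 0.
Hypothesis derive_r : forall w, I w -> is_derive w 1 r (Z ^+ 2 / 2 * (slope (r w))^-1).

Lemma is_derive_shift_of b w x : I w ->
  is_derive w 1 (shift_of b) (eval (d_shift b) w x).
Proof.
move=> Iw; have dr := derive_r Iw; have r0 := r_gt0 Iw.
have q0 := sqrtD1sqr_gt0 (r w).
rewrite /shift_of /d_shift; case: b => /=.
  rewrite mulr1 mulrC.
  exact: (@is_derive1_comp R arsinh r w _ _ (is_derive_arsinh (r w)) dr).
have rn0 : r w != 0 by rewrite gt_eqF.
have drV := @is_deriveV R r w _ 1 rn0 dr.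
have := @is_derive1_comp R arsinh (fun w => (r w)^-1) w _ _ (is_derive_arsinh _) drV.
rewrite /comp; move/is_derive_eq; apply.
by rewrite sqrtD1sqrV// /GRing.scale /=; field; rewrite rn0 slope_neq0// gt_eqF.
Qed.

Lemma is_derive_dw_gen g w x : I w ->
  is_derive w 1 (eval_gen g ^~ x) (eval (dw_gen g) w x).
Proof.
move=> Iw; have w0 := I_gt0 Iw; have dr := derive_r Iw; have r0 := r_gt0 Iw.
have sl0 := slope_neq0 Iw.
have q0 := sqrtD1sqr_gt0 (r w).
have dsq : is_derive w 1 Num.sqrt (1 / 2 * (Num.sqrt w)^-1).
  have := is_derive1_sqrt w0; move/is_derive_eq; apply.
  by rewrite invfM mul1r.
have sw0 : Num.sqrt w != 0 by rewrite gt_eqF// sqrtr_gt0.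
have rn0 : r w != 0 by rewrite gt_eqF.
have dphase b : is_derive w 1 (fun w => Num.sqrt w * (x - L) + shift_of b w)
    (eval (d_phase b) w x).
  have ds := is_derive_shift_of b x Iw.
  apply: is_derive_eq; rewrite /GRing.scale /=; ring.
case: g => [||||||||| b | b] /=.
- exact: dsq.
- by apply: is_derive_eq; rewrite /GRing.scale /=; field.
- exact: dr.
- by apply: is_derive_eq; rewrite /GRing.scale /=; field; rewrite rn0.
- have s0 : 0 < 1 + r w ^+ 2 by rewrite ltr_wpDr ?sqr_ge0.
  have d1 : is_derive w 1 (fun w => 1 + r w ^+ 2) (2 * r w * (Z ^+ 2 / 2 * (slope (r w))^-1)).
    by apply: is_derive_eq; rewrite /GRing.scale /=; ring.
  have d2 := @is_derive1_comp R Num.sqrt (fun w => 1 + r w ^+ 2) w _ _ (is_derive1_sqrt s0) d1.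
  have := @is_deriveV R _ w _ 1 (lt0r_neq0 q0) d2.
  move/is_derive_eq; apply; rewrite /GRing.scale /comp /=.
  by field; rewrite sl0 lt0r_neq0.
- set D := Z ^+ 2 / 2 * (slope (r w))^-1 in dr *.
  have d1 : is_derive w 1 (fun w => slope (r w))
     (- n * (D * (r w)^-1 ^+ 2) * (m * r w - n * (r w)^-1 ^+ 2) +
      (n * (r w)^-1 + m) * (m * D + 2 * n * D * (r w)^-1 ^+ 3)).
    by rewrite /slope; apply: is_derive_eq; rewrite /GRing.scale /=; field; rewrite rn0.
  have := @is_deriveV R _ w _ 1 sl0 d1.
  move/is_derive_eq; apply; rewrite /GRing.scale /= -/D; field.
  by rewrite sl0 rn0.
- have dt : is_derive w 1 (fun w => t * w) t.
    by apply: is_derive_eq; rewrite /GRing.scale /=; ring.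
  have := @is_derive1_comp R (@cos R) _ w _ _ (is_derive_cos _) dt.
  by move/is_derive_eq; apply => /=; ring.
- have dt : is_derive w 1 (fun w => t * w) t.
    by apply: is_derive_eq; rewrite /GRing.scale /=; ring.
  have := @is_derive1_comp R (@sin R) _ w _ _ (is_derive_sin _) dt.
  by move/is_derive_eq; apply => /=; ring.
- exact: is_derive_cst.
- have := @is_derive1_comp R sech _ w _ _ (is_derive_sech _) (dphase b).
  by move/is_derive_eq; apply => /=; ring.
- have := @is_derive1_comp R tanh _ w _ _ (is_derive_tanh _) (dphase b).
  by move/is_derive_eq; apply => /=; ring.
Qed.

Lemma is_derive_dx_gen g w x : is_derive x 1 (eval_gen g w) (eval (dx_gen g) w x).
Proof.
have dphase b : is_derive x 1 (fun x => Num.sqrt w * (x - L) + shift_of b w) (Num.sqrt w).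
  by apply: is_derive_eq; rewrite /GRing.scale /=; ring.
case: g => [||||||||| b | b] /=; try exact: is_derive_cst.
- by apply: is_derive_eq; ring.
- have := @is_derive1_comp R sech _ x _ _ (is_derive_sech _) (dphase b).
  by move/is_derive_eq; apply => /=; ring.
- have := @is_derive1_comp R tanh _ x _ _ (is_derive_tanh _) (dphase b).
  by move/is_derive_eq; apply => /=; ring.
Qed.

Lemma is_derive_dw e w x : I w -> is_derive w 1 (eval e ^~ x) (eval (dw e) w x).
Proof.
move=> Iw; elim: e => [c|g|a IHa b IHb|a IHa b IHb] /=.
- exact: is_derive_cst.
- exact: is_derive_dw_gen.
- exact: is_deriveD.
- by have := is_deriveM IHa IHb; move/is_derive_eq; apply; rewrite /GRing.scale /=; ring.
Qed.

Lemma is_derive_dx e w x : is_derive x 1 (eval e w) (eval (dx e) w x).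
Proof.
elim: e => [c|g|a IHa b IHb|a IHa b IHb] /=.
- exact: is_derive_cst.
- exact: is_derive_dx_gen.
- exact: is_deriveD.
- by have := is_deriveM IHa IHb; move/is_derive_eq; apply; rewrite /GRing.scale /=; ring.
Qed.

(** The commutator of two derivations is a derivation, so it vanishes once it does on the
    generators. The two sides differ as syntax and agree in value. *)
Lemma dx_dw e w x : eval (dx (dw e)) w x = eval (dw (dx e)) w x.
Proof.
elim: e => [c|g|a IHa b IHb|a IHa b IHb] //=.
- by case: g => [||||||||| [] | []] /=; ring.
- by rewrite IHa IHb.
- by rewrite IHa IHb; ring.
Qed.

(* A factor sech survives differentiation and dominates the other generators,
   which grow at most linearly in x. *)
Fixpoint sech_divides e : bool :=
  match e with
  | Gen (GSech _) => true
  | Add a b => sech_divides a && sech_divides b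
  | Mul a b => sech_divides a || sech_divides b
  | _ => false
  end.

Lemma sech_divides_dw e : sech_divides e -> sech_divides (dw e).
Proof.
elim: e => [c|g|a IHa b IHb|a IHa b IHb] //=.
- by case: g.
- by move=> /andP[/IHa -> /IHb ->].
- by case/orP => h; [rewrite h (IHa h)|rewrite h (IHb h) !orbT].
Qed.

Lemma sech_divides_dx e : sech_divides e -> sech_divides (dx e).
Proof.
elim: e => [c|g|a IHa b IHb|a IHa b IHb] //=.
- by case: g.
- by move=> /andP[/IHa -> /IHb ->].
- by case/orP => h; [rewrite h (IHa h)|rewrite h (IHb h) !orbT].
Qed.

(** Quantifying over every rate [k] makes the class stable under products, by splitting [k] in
    halves, and lets a decaying factor of unknown rate keep half of its decay. *)
Definition subexponential (F : R -> R -> R) w := forall k, 0 < k -> exists C,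
  0 <= C /\ \forall v \near w, forall x, L <= x -> `|F v x| <= C * expR (k * (x - L)).

Lemma expR_ge1 k x : 0 <= k -> L <= x -> 1 <= expR (k * (x - L)).
Proof. by move=> k0 Lx; rewrite -expR0 ler_expR mulr_ge0// subr_ge0. Qed.

Lemma subexponential_bounded (F : R -> R -> R) C w : 0 <= C ->
  (\forall v \near w, forall x, `|F v x| <= C) -> subexponential F w.
Proof.
move=> C0 HF k k0; exists C; split=> //; apply: filterS HF => v Hv x Lx.
by apply: (le_trans (Hv x)); rewrite ler_peMr// expR_ge1// ltW.
Qed.

Lemma subexponential_coef (c : R -> R) w : {for w, continuous c} ->
  subexponential (fun v _ => c v) w.
Proof.
move=> cc; apply: (@subexponential_bounded _ (`|c w| + 1)); first by rewrite addr_ge0.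
have /cvgrPdist_lt/(_ 1 ltr01) := cc; apply: filterS => v cv _.
rewrite -[c v](subrK (c w)) addrC (le_trans (ler_normD _ _))// lerD2l distrC ltW//.
Qed.

Lemma subexponential_eval e w : I w -> subexponential (eval e) w.
Proof.
move=> Iw; elim: e => [c|g|a IHa b IHb|a IHa b IHb] k k0 /=.
- by apply: (@subexponential_coef (fun=> c)) k0; exact: cvg_cst.
- have cgen : (forall v x, eval_gen g v x = eval_gen g v L) -> exists C,
      0 <= C /\ \forall v \near w, forall x, L <= x ->
      `|eval_gen g v x| <= C * expR (k * (x - L)).
    move=> gE.
    have [|C [C0 HC]] := @subexponential_coef (eval_gen g ^~ L) w _ k k0.
      apply/differentiable_continuous; rewrite -derivable1_diffP.
      by have [] := is_derive_dw_gen g L Iw.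
    by exists C; split=> //; apply: filterS HC => v Hv x Lx; rewrite gE; exact: Hv.
  case: g cgen => [||||||||| b | b] cgen; try by apply: cgen.
  (* [GPos] is the one unbounded generator; with [y = x - L] the constant comes from
     [k * y <= 1 + k * y <= expR (k * y)]. *)
  + exists k^-1; split; first by rewrite invr_ge0 ltW.
    near=> v => x Lx /=.
    rewrite ger0_norm ?subr_ge0// mulrC ler_pdivlMr// mulrC.
    by rewrite (le_trans _ (expR_ge1Dx _))// lerDr.
  + apply: (@subexponential_bounded _ 1) k0 => //.
    by near=> v => x /=; rewrite gtr0_norm ?sech_gt0// sech_le1.
  + apply: (@subexponential_bounded _ 1) k0 => //.
    by near=> v => x /=; exact: norm_tanh_le1.
- have [Ca [Ca0 Ha]] := IHa k k0; have [Cb [Cb0 Hb]] := IHb k k0.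
  exists (Ca + Cb); split; first exact: addr_ge0.
  near=> v => x Lx; rewrite mulrDl (le_trans (ler_normD _ _))// lerD//.
    by move: x Lx; near: v.
  by move: x Lx; near: v.
- have k20 : 0 < k / 2 by rewrite divr_gt0.
  have [Ca [Ca0 Ha]] := IHa _ k20; have [Cb [Cb0 Hb]] := IHb _ k20.
  exists (Ca * Cb); split; first exact: mulr_ge0.
  near=> v => x Lx.
  have -> : k * (x - L) = k / 2 * (x - L) + k / 2 * (x - L) by field.
  rewrite expRD mulrACA normrM ler_pM//.
    by move: x Lx; near: v.
  by move: x Lx; near: v.
Unshelve. all: by end_near.
Qed.

Lemma shift_of_gt0 b w : I w -> 0 < shift_of b w.
Proof. by move=> Iw; case: b; rewrite arsinh_gt0 ?invr_gt0 r_gt0. Qed.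

Lemma continuous_sqrt_pt w : 0 < w -> {for w, continuous (@Num.sqrt R)}.
Proof.
move=> w0; apply/differentiable_continuous; rewrite -derivable1_diffP.
by have [] := is_derive1_sqrt w0.
Qed.

Hypothesis open_I : open I.

Lemma locally_decaying_sech b w : I w -> locally_decaying L (eval (Gen (GSech b))) w.
Proof.
move=> Iw; have w0 : 0 < Num.sqrt w by rewrite sqrtr_gt0 I_gt0.
have h0 : 0 < Num.sqrt w / 2 by rewrite divr_gt0.
(* Near [w] the actual rate [sqrt v] stays above half of [sqrt w], and a positive shift only lowers
   the bound [2 * expR (- y)] on [sech y]. *)
exists 2, (Num.sqrt w / 2); split=> //.
near=> v => x Lx /=; rewrite gtr0_norm ?sech_gt0//.
apply: (le_trans (sech_le_expR _)); rewrite ler_pM2l// ler_expR lerN2.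
have Iv : I v by near: v; exact: open_nbhs_nbhs.
apply: ler_wpDr; first by rewrite ltW// shift_of_gt0.
rewrite ler_wpM2r ?subr_ge0//.
have : `|Num.sqrt w - Num.sqrt v| < Num.sqrt w / 2.
  near: v; have /cvgrPdist_lt := continuous_sqrt_pt (I_gt0 Iw); exact.
by rewrite ltr_norml => /andP[_]; lra.
Unshelve. all: by end_near.
Qed.

Lemma locally_decaying_mul (F G : R -> R -> R) w : subexponential F w ->
  locally_decaying L G w -> locally_decaying L (fun v x => F v x * G v x) w.
Proof.
move=> hF [C [k [k0 HG]]].
have k20 : 0 < k / 2 by rewrite divr_gt0.
have [D [D0 HF]] := hF _ k20.
exists (D * C), (k / 2); split=> //.
near=> v => x Lx.
have -> : - (k / 2 * (x - L)) = k / 2 * (x - L) + - (k * (x - L)) by field.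
rewrite expRD mulrACA normrM ler_pM//.
  by move: x Lx; near: v.
by move: x Lx; near: v.
Unshelve. all: by end_near.
Qed.

Lemma locally_decaying_eval e w : I w -> sech_divides e -> locally_decaying L (eval e) w.
Proof.
move=> Iw; elim: e => [c|g|a IHa b IHb|a IHa b IHb] //=.
- by case: g => // b _; exact: locally_decaying_sech.
- move=> /andP[/IHa[C [k [k0 Ha]]] /IHb[C' [k' [k'0 Hb]]]].
  exists (Num.max `|C| `|C'| + Num.max `|C| `|C'|), (Num.min k k').
  split; first by rewrite lt_min k0.
  near=> v => x Lx; rewrite mulrDl (le_trans (ler_normD _ _))// lerD//.
    apply: (@le_trans _ _ (C * expR (- (k * (x - L))))); first by move: x Lx; near: v.
    by apply: expR_decay_le => //; rewrite ?ge_min ?le_max ?ler_norm ?lexx.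
  apply: (@le_trans _ _ (C' * expR (- (k' * (x - L))))); first by move: x Lx; near: v.
  by apply: expR_decay_le => //; rewrite ?ge_min ?le_max ?ler_norm ?lexx ?orbT.
- case/orP => [/IHa|/IHb] h.
    have := locally_decaying_mul (subexponential_eval b Iw) h.
    by under eq_fun do under eq_fun do rewrite mulrC.
  exact: locally_decaying_mul (subexponential_eval a Iw) h.
Unshelve. all: by end_near.
Qed.

End profile_algebra.

(** * The shifts as functions of the frequency *)

Section root.
Context {R : realType}.
Variables (n m Z : R).
Hypotheses (n_gt0 : 0 < n) (m_gt0 : 0 < m) (Z_neq0 : Z != 0).
Implicit Types x y w : R.

(* With y = sinh a1 and 1 / y = sinh aN, the vertex conditions amount to
   height y = Z ^ 2 * omega. *)
Definition height y : R := (1 + y ^+ 2) * (n * y^-1 + m) ^+ 2.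

Local Notation slope := (slope n m).

Lemma is_derive_height y : 0 < y -> is_derive y 1 height (2 * slope y).
Proof.
move=> y0; have yn0 : y != 0 by rewrite gt_eqF.
have dV := @is_deriveV R id y _ 1 yn0 (is_derive_id _ _).
rewrite /height; apply: is_derive_eq; rewrite /GRing.scale /= /slope.
by field; rewrite yn0.
Qed.

Lemma slope_lt0 y : 0 < y -> m * y ^+ 3 < n -> slope y < 0.
Proof.
move=> y0 yn; have yn0 : y != 0 by rewrite gt_eqF.
rewrite /slope pmulr_rlt0; last by rewrite addr_gt0// mulr_gt0// invr_gt0.
have -> : m * y - n * y^-1 ^+ 2 = (m * y ^+ 3 - n) / y ^+ 2 by field.
by rewrite pmulr_llt0 ?invr_gt0 ?exprn_gt0// subr_lt0.
Qed.

(** The bound on [y] is non-strict so that the critical point may be the right end; the mean value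
    theorem evaluates [slope] strictly before it. *)
Lemma height_decr x y : 0 < x -> x < y -> m * y ^+ 3 <= n -> height y < height x.
Proof.
move=> x0 xy yn.
have dh c : x <= c -> is_derive c 1 height (2 * slope c).
  by move=> xc; apply: is_derive_height; exact: lt_le_trans xc.
have [||c] := @MVT R height (fun c => 2 * slope c) x y xy.
- by move=> c; rewrite in_itv /= => /andP[xc _]; apply: dh; exact: ltW.
- apply: derivable_within_continuous => c; rewrite in_itv /= => /andP[xc _].
  by have [] := dh c xc.
- rewrite in_itv /= => /andP[xc cy] E.
  rewrite -subr_lt0 E pmulr_llt0 ?subr_gt0// pmulr_rlt0//.
  have c0 := lt_trans x0 xc.
  apply: slope_lt0 => //; apply: lt_le_trans yn; rewrite ltr_pM2l//.
  by rewrite ltrXn2r// ?nnegrE ltW// (lt_trans c0).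
Qed.

Definition threshold := (n `^ (2 / 3) + m `^ (2 / 3)) ^+ 3 / Z ^+ 2.

(** With [a], [b] the cube roots of [n], [m], the height of [a / b] is [(a ^+ 2 + b ^+ 2) ^+ 3];
    this is the origin of the exponents in [threshold]. *)
Lemma critical_point : exists2 y0, 0 < y0 & m * y0 ^+ 3 = n /\ height y0 = Z ^+ 2 * threshold.
Proof.
pose a := n `^ (1 / 3); pose b := m `^ (1 / 3).
have cube c : 0 < c -> (c `^ (1 / 3)) ^+ 3 = c.
  move=> c0; rewrite -powR_mulrn ?powR_ge0// -powRrM (_ : 1 / 3 * 3%:R = 1); last by field.
  by rewrite powRr1// ltW.
have square c : 0 < c -> c `^ (2 / 3) = (c `^ (1 / 3)) ^+ 2.
  by move=> c0; rewrite -powR_mulrn ?powR_ge0// -powRrM; congr (_ `^ _); field.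
have [a0 b0] : 0 < a /\ 0 < b by rewrite !powR_gt0.
have [an0 bn0] : a != 0 /\ b != 0 by rewrite !gt_eqF.
have [a3 b3] : a ^+ 3 = n /\ b ^+ 3 = m by rewrite !cube.
exists (a / b); first exact: divr_gt0.
rewrite /threshold !square// -/a -/b /height -a3 -b3; split; first by field.
by field; rewrite Z_neq0 an0 bn0.
Qed.

Lemma cube_le x y : 0 < x -> 0 < y -> (m * x ^+ 3 <= m * y ^+ 3) = (x <= y).
Proof. by move=> x0 y0; rewrite ler_pM2l// ler_pXn2r// nnegrE ltW. Qed.

Lemma cube_lt x y : 0 < x -> 0 < y -> (m * x ^+ 3 < m * y ^+ 3) = (x < y).
Proof. by move=> x0 y0; rewrite !ltNge cube_le. Qed.

Lemma height_root w : threshold < w ->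
  exists y, [/\ 0 < y, m * y ^+ 3 < n & height y = Z ^+ 2 * w].
Proof.
move=> tw; have [y0 y00 [y0n hy0]] := critical_point.
have Z2 : 0 < Z ^+ 2 by rewrite exprn_even_gt0.
have t0 : 0 <= threshold.
  by rewrite /threshold divr_ge0 ?sqr_ge0// exprn_ge0// addr_ge0// powR_ge0.
have w0 : 0 < Z ^+ 2 * w by rewrite mulr_gt0// (le_lt_trans t0).
(* As [height y >= (n / y) ^+ 2], any positive point up to [n / sqrt (Z ^+ 2 * w)] has height at
   least [Z ^+ 2 * w]; it is the left end for the intermediate value theorem. *)
pose e := Num.min y0 (n / Num.sqrt (Z ^+ 2 * w)).
have e0 : 0 < e by rewrite lt_min y00 divr_gt0// sqrtr_gt0.
have ey0 : e <= y0 by rewrite ge_min lexx.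
have he : Z ^+ 2 * w <= height e.
  have sw : Num.sqrt (Z ^+ 2 * w) <= n * e^-1.
    rewrite ler_pdivlMr// mulrC -ler_pdivlMr ?sqrtr_gt0//.
    by rewrite ge_min lexx orbT.
  rewrite -(sqr_sqrtr (ltW w0)) /height -[X in X <= _]mul1r.
  apply: ler_pM; rewrite ?sqr_ge0 ?lerDl ?sqr_ge0//.
  rewrite ler_pXn2r// ?nnegrE ?sqrtr_ge0//.
    by rewrite (le_trans sw)// lerDl ltW.
  by rewrite addr_ge0 ?mulr_ge0 ?invr_ge0 ?ltW.
have hy0w : height y0 < Z ^+ 2 * w by rewrite hy0 ltr_pM2l.
have [||y] := @IVT R height e y0 (Z ^+ 2 * w) ey0.
- apply: derivable_within_continuous => c; rewrite in_itv /= => /andP[ec _].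
  by have [] := is_derive_height (lt_le_trans e0 ec).
- by rewrite ge_min le_max (ltW hy0w) he orbT.
- rewrite in_itv /= => /andP[ey yy0] hy; have y_gt0 := lt_le_trans e0 ey.
  exists y; split=> //; rewrite -y0n cube_lt// lt_neqAle yy0 andbT.
  by apply/eqP => E; move: hy0w; rewrite -E hy ltxx.
Qed.

Lemma height_lt_threshold y : 0 < y -> m * y ^+ 3 < n -> threshold < height y / Z ^+ 2.
Proof.
move=> y0; have [y1 y10 [y1n hy1]] := critical_point.
have Z2 : 0 < Z ^+ 2 by rewrite exprn_even_gt0.
rewrite -{1}y1n cube_lt// => yy1.
by rewrite ltr_pdivlMr// mulrC -hy1 height_decr// y1n.
Qed.

Lemma height_inj x y : 0 < x -> 0 < y -> m * x ^+ 3 < n -> m * y ^+ 3 < n ->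
  height x = height y -> x = y.
Proof.
move=> x0 y0 xn yn E; case: (ltgtP x y) => // xy.
  by have := height_decr x0 xy (ltW yn); rewrite E ltxx.
by have := height_decr y0 xy (ltW xn); rewrite E ltxx.
Qed.

(** [r] is a bare selection of roots. Uniqueness of the root makes it a left inverse of
    [height / Z ^+ 2] around [r w], and the derivative of an inverse function then gives its
    regularity. *)
Lemma is_derive_root (r : R -> R) :
  (forall w, threshold < w -> [/\ 0 < r w, m * r w ^+ 3 < n & height (r w) = Z ^+ 2 * w]) ->
  forall w, threshold < w -> is_derive w 1 r (Z ^+ 2 / 2 * (slope (r w))^-1).
Proof.
move=> rP w tw; have [rw0 rwn hrw] := rP w tw.
have [y1 y10 [y1n hy1]] := critical_point.
have Z2 : 0 < Z ^+ 2 by rewrite exprn_even_gt0.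
have sl := slope_lt0 rw0 rwn.
pose f y := height y / Z ^+ 2.
have fr v : threshold < v -> f (r v) = v.
  by move=> tv; rewrite /f; have [_ _ ->] := rP v tv; rewrite mulrC mulKf ?expf_neq0.
have df y : 0 < y -> is_derive y 1 f (2 * slope y / Z ^+ 2).
  move=> y0; have dh := is_derive_height y0.
  by apply: is_derive_eq; rewrite /GRing.scale /=; ring.
have near_r : \forall y \near r w, y \in `]0, y1[.
  by apply: near_in_itvoo; rewrite in_itv /= rw0 -cube_lt// y1n.
rewrite -[X in is_derive X](fr w tw).
have -> : Z ^+ 2 / 2 * (slope (r w))^-1 = (2 * slope (r w) / Z ^+ 2)^-1.
  by field; rewrite Z_neq0 lt_eqF.
apply: is_derive_inverse; last 2 first.
- exact: df.
- apply: mulf_neq0; last by rewrite invr_neq0 ?expf_neq0.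
  by apply: mulf_neq0; [rewrite pnatr_eq0|rewrite lt_eqF].
- near=> y; have /andP[y0 yy1] : 0 < y < y1.
    by have : y \in `]0, y1[ by near: y.
  have yn : m * y ^+ 3 < n by rewrite -y1n cube_lt.
  have [ry0 ryn hry] := rP _ (height_lt_threshold y0 yn).
  by apply: height_inj => //; rewrite hry mulrC divfK// gt_eqF.
- near=> y; have /andP[y0 yy1] : 0 < y < y1.
    by have : y \in `]0, y1[ by near: y.
  apply/differentiable_continuous; rewrite -derivable1_diffP.
  by have [] := df y y0.
Unshelve. all: by end_near.
Qed.

End root.

(** * The standing waves *)

Lemma edges_gt0 (R : realType) (N n : nat) : (1 <= n <= N - 1)%N ->
  0 < n%:R :> R /\ 0 < (N - n)%:R :> R.
Proof. by move=> hn; rewrite !ltr0n; lia. Qed.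

Section waves.
Context {R : realType}.
Variables (L Z : R) (N n : nat) (r : R -> R).
Hypotheses (hZ : Z < 0) (hn : (1 <= n <= N - 1)%N).
Implicit Types (t w x : R) (b : bool).

Local Notation nR := (n%:R : R).
Local Notation mR := ((N - n)%:R : R).

Definition frequencies : set R := [set w | omega_star Z N n < w].

Hypothesis rP : forall w, frequencies w ->
  [/\ 0 < r w, mR * r w ^+ 3 < nR & height nR mR (r w) = Z ^+ 2 * w].

Lemma nR_gt0 : 0 < nR. Proof. by have [] := edges_gt0 R hn. Qed.

Lemma mR_gt0 : 0 < mR. Proof. by have [] := edges_gt0 R hn. Qed.

Lemma Z_neq0 : Z != 0. Proof. by rewrite lt_eqF. Qed.

Lemma frequencies_gt0 w : frequencies w -> 0 < w.
Proof.
apply: le_lt_trans.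
by rewrite divr_ge0 ?sqr_ge0// exprn_ge0// addr_ge0// powR_ge0.
Qed.

Lemma open_frequencies : open frequencies.
Proof. exact: open_gt. Qed.

Lemma root_gt0 w : frequencies w -> 0 < r w.
Proof. by case/rP. Qed.

Lemma slope_root_neq0 w : frequencies w -> slope nR mR (r w) != 0.
Proof.
move=> /rP[r0 rn _]; rewrite lt_eqF//; apply: slope_lt0 => //.
  exact: nR_gt0.
exact: mR_gt0.
Qed.

Lemma derive_root w : frequencies w ->
  is_derive w 1 r (Z ^+ 2 / 2 * (slope nR mR (r w))^-1).
Proof. by apply: is_derive_root; [exact: nR_gt0|exact: mR_gt0|exact: Z_neq0|exact: rP]. Qed.

(** The square root of the height equation, with the sign settled by [Z < 0]; up to a common factor
    it is the condition on the sum of the vertex values. *)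
Lemma sqrt_frequency w : frequencies w ->
  - Z * Num.sqrt w = Num.sqrt (1 + r w ^+ 2) * (nR / r w + mR).
Proof.
move=> Iw; have [r0 _ hr] := rP Iw; have w0 := frequencies_gt0 Iw.
apply: (@pexpIrn _ 2) => //; rewrite ?nnegrE.
- by rewrite mulr_ge0 ?sqrtr_ge0// oppr_ge0 ltW.
- by rewrite mulr_ge0 ?sqrtr_ge0// addr_ge0// divr_ge0// ltW.
- by rewrite !exprMn sqr_sqrtD1sqr sqrrN sqr_sqrtr ?ltW// -hr.
Qed.

Definition profile_expr (c : generator) b : expr R :=
  Mul (Mul (Mul (Cst (Num.sqrt 2)) (Gen GSqrt)) (Gen c)) (Gen (GSech b)).

Definition wave : R -> gfun R N :=
  fun w => Theta L N n w (shift_of r true w) (shift_of r false w).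

Definition edge (j : 'I_N) : bool := (j < n)%N.

Lemma waveE w j x : wave w j x = (Psi L w (shift_of r (edge j) w) x)%:C%C.
Proof. by rewrite /wave /Theta /edge; case: ltnP. Qed.

Lemma rotate_wave t w : rotate (t * w) (wave w) =
  family (eval L nR mR t r) (profile_expr GCos \o edge) (profile_expr GSin \o edge) w.
Proof.
apply/funext => j; apply/funext => x; rewrite /rotate waveE /family /= /expi /Psi.
rewrite sqrtrM ?ler0n//; simpc; congr (_ +i* _)%C; ring.
Qed.

Lemma sum_edge (f : bool -> R) : \sum_(j < N) f (edge j) = nR * f true + mR * f false.
Proof.
have nN : (n <= N)%N by case/andP: hn => _; lia.
rewrite -(big_mkord xpredT (fun j => f (j < n)%N)) (big_cat_nat (n := n))//=.
rewrite (eq_big_nat _ _ (F2 := fun=> f true)); last by move=> j /andP[_ ->].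
rewrite [X in _ + X](eq_big_nat _ _ (F2 := fun=> f false)); last first.
  by move=> j /andP[nj _]; rewrite ltnNge nj.
by rewrite !sumr_const_nat subn0 !mulr_natl.
Qed.

Local Notation ev t := (eval L nR mR t r).
Local Notation dx := (derivation (@dx_gen R)).

Lemma vertex_profile t (c : generator) : (c = GCos \/ c = GSin) ->
  vertex_condition L Z frequencies (ev t) dx (profile_expr c \o edge).
Proof.
move=> hc w Iw i.
have [r0 _ hr] := rP Iw; have rn0 : r w != 0 by rewrite gt_eqF.
have q0 : Num.sqrt (1 + r w ^+ 2) != 0 by rewrite gt_eqF// sqrtD1sqr_gt0.
have sV := sqrtD1sqrV r0.
have zE (s : R) : Num.sqrt w * (L - L) + s = s by rewrite subrr mulr0 add0r.
(* The right side does not mention [b]: sech * tanh equals [r / (1 + r ^+ 2)] at either shift. *)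
have dE b : ev t (dx (profile_expr c b)) w L =
    - (Num.sqrt 2 * Num.sqrt w * eval_gen L nR mR t r c w L * Num.sqrt w *
       (r w / Num.sqrt (1 + r w ^+ 2) ^+ 2)).
  case: hc => -> /=; rewrite !zE /shift_of; case: b;
  by rewrite sech_arsinh tanh_arsinh ?sV; field; rewrite ?q0 ?rn0.
split=> [j|]; first exact: etrans (dE _) (esym (dE _)).
rewrite [X in _ = Z * X](dE (edge i)) (sum_edge (fun b => ev t (profile_expr c b) w L)) /=.
rewrite !zE !sech_arsinh sV.
set A := Num.sqrt 2 * Num.sqrt w * eval_gen L nR mR t r c w L.
have -> : Z * - (A * Num.sqrt w * (r w / Num.sqrt (1 + r w ^+ 2) ^+ 2)) =
  A * (- Z * Num.sqrt w) * (r w / Num.sqrt (1 + r w ^+ 2) ^+ 2) by ring.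
rewrite sqrt_frequency//; field.
by rewrite q0 rn0.
Qed.

(** The profile equation Psi'' = w Psi - Psi^3, from sech'' = sech - 2 sech^3 and the amplitude
    [sqrt (2 * w)]; it is written with Psi^2 as a coefficient so as to include the phase factor. *)
Lemma dxdx_profile t (c : generator) b w x : (c = GCos \/ c = GSin) -> 0 < w ->
  ev t (dx (dx (profile_expr c b))) w x =
  (w - Psi L w (shift_of r b w) x ^+ 2) * ev t (profile_expr c b) w x.
Proof.
move=> hc w0; rewrite /Psi sqrtrM ?ler0n// 2!exprMn sqr_sqrtr ?ler0n// sqr_sqrtr ?ltW//.
have := sqr_sqrtr (ltW w0).
have := sech2_tanh2 (Num.sqrt w * (x - L) + shift_of r b w).
case: hc => -> /=; set sh := sech _; set th := tanh _; set q := Num.sqrt w;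
  move=> /(canRL (addKr _)) T2 q2; [set a := cos _ | set a := sin _];
  transitivity (Num.sqrt 2 * q * a * (q ^+ 2 * (sh * th ^+ 2 - sh ^+ 3)));
  by [ring | rewrite T2 q2; ring].
Qed.

(** [smooth_families] demands decay of every name, which holds only for expressions with a factor
    sech; both derivations preserve this subtype. *)
Definition decaying_expr := {e : expr R | sech_divides e}.

Definition dw_decaying t (e : decaying_expr) : decaying_expr :=
  @exist _ (fun e => sech_divides e) _ (sech_divides_dw Z nR mR t (svalP e)).

Definition dx_decaying (e : decaying_expr) : decaying_expr :=
  @exist _ (fun e => sech_divides e) _ (sech_divides_dx (svalP e)).

Definition wave_expr (c : generator) (j : 'I_N) : decaying_expr :=
  @exist _ (fun e => sech_divides e) (profile_expr c (edge j)) (orbT _).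

Local Notation evd t := (fun e : decaying_expr => ev t (sval e)).

Lemma decaying_dw t (e : decaying_expr) w x : frequencies w ->
  is_derive w 1 (evd t e ^~ x) (evd t (dw_decaying t e) w x).
Proof.
move=> Iw.
exact: (@is_derive_dw R L Z nR mR t r frequencies frequencies_gt0 root_gt0
  slope_root_neq0 derive_root).
Qed.

Lemma decaying_dx t (e : decaying_expr) w x :
  is_derive x 1 (evd t e w) (evd t (dx_decaying e) w x).
Proof. exact: is_derive_dx. Qed.

Lemma decaying_eval t (e : decaying_expr) w : frequencies w ->
  locally_decaying L (evd t e) w.
Proof.
case: e => e he Iw.
exact: (@locally_decaying_eval R L Z nR mR t r frequencies frequencies_gt0 root_gt0
  slope_root_neq0 derive_root open_frequencies e w Iw he).
Qed.

Lemma smooth_curve_wave t : smooth_curve L Z frequencies (fun w => rotate (t * w) (wave w)).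
Proof.
rewrite (_ : (fun w => _) = family (evd t) (wave_expr GCos) (wave_expr GSin)); last first.
  by apply/funext => w; rewrite rotate_wave.
apply: (@smooth_curve_family R L Z N frequencies _ (evd t) (dw_decaying t) dx_decaying
  open_frequencies (@decaying_dw t) (fun e w x _ => decaying_dx t e w x)
  (fun e w x _ => dx_dw _ _ _ _ _ _ _ _ _) (@decaying_eval t)).
- by apply: vertex_profile; left.
- by apply: vertex_profile; right.
Qed.

Lemma deltap_graph_rotate_wave t w : frequencies w ->
  deltap_graph L Z (rotate (t * w) (wave w))
    (fun j x => (Psi L w (shift_of r (edge j) w) x ^+ 2 - w)%:C%C *
                rotate (t * w) (wave w) j x).
Proof.
move=> Iw; have w0 := frequencies_gt0 Iw.
rewrite rotate_wave.
have := @deltap_graph_family _ L Z N frequencies _ (evd t) dx_decaying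
  (fun e w x _ => decaying_dx t e w x) (decaying_eval t)
  (wave_expr GCos) (wave_expr GSin) w Iw
  (vertex_profile t (or_introl erefl)) (vertex_profile t (or_intror erefl)).
congr (deltap_graph _ _ _ _); apply/funext => j; apply/funext => x.
rewrite /family /=.
have := dxdx_profile t (edge j) x (or_introl erefl) w0.
have := dxdx_profile t (edge j) x (or_intror erefl) w0.
move=> /= -> ->.
by simpc; congr (_ +i* _)%C; ring.
Qed.

End waves.

(** * Time evolution of the waves and discontinuity at the vertex *)

Section standing_waves.
Context {R : realType}.
Variables (L Z : R) (N n : nat) (r : R -> R).
Hypotheses (hZ : Z < 0) (hn : (1 <= n <= N - 1)%N).
Implicit Types (t w x : R) (b : bool).
Hypothesis rP : forall w, frequencies Z N n w ->
  [/\ 0 < r w, (N - n)%:R * r w ^+ 3 < n%:R & height n%:R (N - n)%:R (r w) = Z ^+ 2 * w].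

Local Notation wave := (@wave R L N n r).
Local Notation amplitude w j := (Psi L w (shift_of r (edge n j) w)).

Lemma continuous_amplitude w (j : 'I_N) : continuous (amplitude w j).
Proof.
have d x := is_derive_dx L n%:R (N - n)%:R 0 r (Gen (GSech (edge n j))) w x.
move=> x; apply: cvgMr; exact: (is_derive_continuous d).
Qed.

Lemma exp_decay_amplitude w (j : 'I_N) : frequencies Z N n w -> exp_decay L (amplitude w j).
Proof.
move=> Iw; apply: exp_decayZ.
have := locally_decaying_sech L n%:R (N - n)%:R 0 (@frequencies_gt0 R Z N n)
  (root_gt0 rP) (@open_frequencies R Z N n) (edge n j) Iw.
exact: locally_decaying_at.
Qed.

Lemma rotate_waveE (w a x : R) (j : 'I_N) : rotate a (wave w) j x =
  ((cos a * amplitude w j x) +i* (sin a * amplitude w j x))%C.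
Proof. by rewrite /rotate waveE /expi; simpc. Qed.

(** The variable is now time at a fixed frequency: second derivatives are [- w ^+ 2] times the
    components, so the decay of the amplitude bounds them uniformly in time. *)
Lemma curve_derivative_rotate_wave w t : frequencies Z N n w ->
  curve_derivative (@L2G_sqnorm R L N) (fun t => rotate (w * t) (wave w))
    (fun t j x => 'i%C * w%:C%C * rotate (w * t) (wave w) j x) t.
Proof.
move=> Iw; rewrite /curve_derivative.
have -> : (0%E : \bar R) = (\sum_(j < N) 0%E)%E by rewrite big1.
apply: cvg_nnesum => [j _|j _]; first by near=> h; exact: L2_sqnorm_ge0.
pose P := amplitude w j.
pose F (s x : R) := cos (w * s) * P x.
pose F1 (s x : R) : R := - w * sin (w * s) * P x.
pose F2 (s x : R) : R := - w ^+ 2 * cos (w * s) * P x.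
pose G (s x : R) := sin (w * s) * P x.
pose G1 (s x : R) : R := w * cos (w * s) * P x.
pose G2 (s x : R) : R := - w ^+ 2 * sin (w * s) * P x.
rewrite (_ : (fun h => _) = (fun h => L2_sqnorm L
    (fun x => remainder F F1 t h x +i* remainder G G1 t h x)%C)); last first.
  apply/funext => h; congr (L2_sqnorm L _); apply/funext => x.
  rewrite !rotate_waveE -complex_remainder; congr (_ - _); rewrite /F1 /G1 -/P.
  by simpc; congr (_ +i* _)%C; ring.
have dws (s : R) : is_derive s 1 (fun s => w * s) w.
  by apply: is_derive_eq; rewrite /GRing.scale /=; ring.
have dcos (s : R) : is_derive s 1 (fun s => cos (w * s)) (- w * sin (w * s)).
  have := @is_derive1_comp R (@cos R) _ s _ _ (is_derive_cos _) (dws s).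
  by move/is_derive_eq; apply; ring.
have dsin (s : R) : is_derive s 1 (fun s => sin (w * s)) (w * cos (w * s)).
  have := @is_derive1_comp R (@sin R) _ s _ _ (is_derive_sin _) (dws s).
  by move/is_derive_eq; apply; ring.
have dscale (a p : R) (c : R -> R) (dc s : R) : is_derive s 1 c dc ->
    is_derive s 1 (fun s => a * c s * p) (a * dc * p).
  move=> hc; have := is_deriveZ (a * p) hc; rewrite /GRing.scale /=.
  rewrite (_ : _ \*: c = fun s => a * c s * p); last first.
    by apply/funext => v; rewrite /GRing.scale /= mulrAC.
  by move/is_derive_eq; apply; rewrite mulrAC.
have cP : continuous P by exact: continuous_amplitude.
have cZ (c : R) : continuous (fun x => c * P x) by move=> x; apply: cvgMr; exact: cP.
have : exp_decay L P by exact: exp_decay_amplitude.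
clearbody P => -[C [k [k0 HP]]].
have decay (c : R -> R) : (forall s, `|c s| <= 1) ->
    locally_decaying L (fun s x => - w ^+ 2 * c s * P x) t.
  move=> c1; exists (w ^+ 2 * C), k; split=> //; near=> s => x Lx.
  rewrite 2!normrM normrN (ger0_norm (sqr_ge0 w)) -(mulrA (w ^+ 2) `|c s|) -(mulrA (w ^+ 2) C).
  apply: (ler_wpM2l (sqr_ge0 w)).
  by apply: le_trans (HP x Lx); rewrite ler_piMl.
apply: (@L2_sqnorm_remainder _ _ F F1 F2 G G1 G2).
- by near=> s => x; apply: is_derive_eq; rewrite /GRing.scale /F1 /=; ring.
- near=> s => x; have := dscale (- w) (P x) _ _ _ (dsin s).
  by move/is_derive_eq; apply; rewrite /F2; ring.
- by near=> s => x; apply: is_derive_eq; rewrite /GRing.scale /G1 /=; ring.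
- near=> s => x; have := dscale w (P x) _ _ _ (dcos s).
  by move/is_derive_eq; apply; rewrite /G2; ring.
- by near=> s; exact: cZ.
- exact: cZ.
- by near=> s; exact: cZ.
- exact: cZ.
- by apply: decay => s; rewrite ler_norml cos_geN1 cos_le1.
- by apply: decay => s; rewrite ler_norml sin_geN1 sin_le1.
Unshelve. all: by end_near.
Qed.

Lemma cubic_rotate_wave (w a x : R) (j : 'I_N) : cubic (rotate a (wave w)) j x =
  (amplitude w j x ^+ 2)%:C%C * rotate a (wave w) j x.
Proof.
rewrite /cubic; congr (_%:C%C * _); rewrite rotate_waveE /=.
rewrite sqr_sqrtr ?addr_ge0 ?sqr_ge0// !exprMn -mulrDl.
by rewrite cos2Dsin2 mul1r.
Qed.

Lemma NLS_solution_wave w : frequencies Z N n w ->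
  NLS_solution L Z (fun t => rotate (w * t) (wave w)).
Proof.
move=> Iw; exists (fun t j x => 'i%C * w%:C%C * rotate (w * t) (wave w) j x).
exists (fun t j x => (amplitude w j x ^+ 2 - w)%:C%C * rotate (w * t) (wave w) j x).
move=> t; split.
- by rewrite mulrC; exact: deltap_graph_rotate_wave.
- move=> j; rewrite (_ : (fun x => _) = (fun x =>
    (- w * sin (w * t) * amplitude w j x) +i* (w * cos (w * t) * amplitude w j x))%C).
    have cZ (c : R) : continuous (fun x => c * amplitude w j x).
      by move=> x; apply: cvgMr; exact: continuous_amplitude.
    by apply: L2_exp_decay; [exact: cZ|exact: cZ|..];
      apply: exp_decayZ; exact: exp_decay_amplitude.
  apply/funext => x; rewrite rotate_waveE.
  by simpc; congr (_ +i* _)%C; ring.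
- exact: curve_derivative_rotate_wave.
- move=> j; apply: aeW => x _; rewrite cubic_rotate_wave.
  set u := rotate _ _ _ _.
  by rewrite !mulrA -expr2 sqr_i rmorphB /=; ring.
Qed.

Lemma rotate0 (U : gfun R N) : rotate 0 U = U.
Proof.
apply/funext => j; apply/funext => x.
by rewrite /rotate /expi cos0 sin0 mul1r.
Qed.

Lemma deltap_graph_wave w : frequencies Z N n w ->
  deltap_graph L Z (wave w) (fun j x => (amplitude w j x ^+ 2 - w)%:C%C * wave w j x).
Proof.
move=> Iw; have := deltap_graph_rotate_wave L hZ hn rP 0 Iw.
by rewrite mul0r rotate0.
Qed.

Lemma stationary_solution_wave w : frequencies Z N n w -> stationary_solution L Z w (wave w).
Proof.
move=> Iw; eexists; split; first exact: deltap_graph_wave.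
move=> j; apply: aeW => x _.
have := cubic_rotate_wave w 0 x j; rewrite rotate0 => ->.
by rewrite rmorphB /=; ring.
Qed.

Lemma deltap_dom_wave w : frequencies Z N n w -> deltap_dom L Z (wave w).
Proof. by move=> Iw; eexists; exact: deltap_graph_wave. Qed.

(** The first and last edges belong to different groups. Equal vertex values there would give the
    two shifts the same cosh, hence [r w = (r w)^-1]. *)
Lemma discontinuous_wave w a : frequencies Z N n w -> r w <> 1 ->
  ~ continuous_at_vertex L (rotate a (wave w)).
Proof.
move=> Iw r1.
have N0 : (0 < N)%N by lia.
have N1 : (N.-1 < N)%N by lia.
move=> /(_ (Ordinal N0) (Ordinal N1)).
rewrite /rotate => /mulfI; rewrite !waveE.
have -> : edge n (Ordinal N0) = true by rewrite /edge /=; lia.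
have -> : edge n (Ordinal N1) = false by rewrite /edge /=; lia.
have -> : expi a != 0.
  apply/eqP => -[c0 s0]; have := cos2Dsin2 a; rewrite c0 s0 expr0n addr0 => /esym/eqP.
  by rewrite oner_eq0.
move=> /(_ isT) [].
have [r0 _ _] := rP Iw; have w0 := frequencies_gt0 Iw.
rewrite /Psi subrr mulr0 !add0r => /mulfI.
rewrite gt_eqF ?sqrtr_gt0 ?mulr_gt0// => /(_ isT).
rewrite !sech_arsinh => /invr_inj /eqP.
rewrite eqr_sqrt ?addr_ge0 ?sqr_ge0// => /eqP/addrI/eqP.
rewrite eqrXn2 ?invr_ge0 ?ltW// => /eqP E; apply: r1.
apply/eqP; rewrite -(@pexpr_eq1 _ _ 2) ?ltW//.
by rewrite expr2 {2}E mulfV// gt_eqF.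
Qed.

End standing_waves.

(** * Position of the root relative to 1 *)

Section shift_types.
Context {R : realType}.
Variables (Z : R) (N n : nat) (r : R -> R).
Hypotheses (hZ : Z < 0) (hn : (1 <= n <= N - 1)%N).
Hypothesis rP : forall w, frequencies Z N n w ->
  [/\ 0 < r w, (N - n)%:R * r w ^+ 3 < n%:R & height n%:R (N - n)%:R (r w) = Z ^+ 2 * w].

Lemma root_lt1 w : (2 * n <= N)%N -> frequencies Z N n w -> r w < 1.
Proof.
move=> nN /rP[r0 rn _]; rewrite ltNge; apply/negP => r1.
have : n%:R <= (N - n)%:R * r w ^+ 3.
  apply: (@le_trans _ _ (N - n)%:R); first by rewrite ler_nat; lia.
  by rewrite ler_peMr// exprn_ege1.
by rewrite leNgt rn.
Qed.

Lemma height1 : height n%:R (N - n)%:R 1 = Z ^+ 2 * omega_hat Z N.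
Proof.
have -> : (N - n)%:R = N%:R - n%:R :> R by rewrite natrB//; lia.
by rewrite /height /omega_hat; field; rewrite lt_eqF.
Qed.

(** Since [N - n < n], the point 1 lies on the decreasing branch of [height] together with [r w], so
    comparing them amounts to comparing heights, in reverse order. *)
Lemma root_omega_hat w : (N < 2 * n)%N -> frequencies Z N n w ->
  ((r w < 1) = (omega_hat Z N < w)) * ((1 < r w) = (w < omega_hat Z N)).
Proof.
move=> Nn Iw; have [r0 rn hr] := rP Iw.
have Z2 : 0 < Z ^+ 2 by rewrite exprn_even_gt0//= lt_eqF.
have [n0 m0] := edges_gt0 R hn.
have mn : (N - n)%:R * 1 ^+ 3 <= n%:R :> R by rewrite expr1n mulr1 ler_nat; lia.
rewrite -(ltr_pM2l Z2 _ w) -(ltr_pM2l Z2 w) -height1 -hr.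
case: (ltgtP (r w) 1) => [r1|r1|->]; last by rewrite ltxx.
  by have h := height_decr n0 m0 r0 r1 mn; rewrite h ltNge ltW.
by have h := height_decr n0 m0 ltr01 r1 (ltW rn); rewrite h ltNge ltW.
Qed.

Lemma frequencies_omega_hat : (N < 2 * n)%N -> frequencies Z N n (omega_hat Z N).
Proof.
move=> Nn; have Z2 : 0 < Z ^+ 2 by rewrite exprn_even_gt0//= lt_eqF.
rewrite /frequencies /= -[omega_hat Z N](mulKf (lt0r_neq0 Z2)) -height1 mulrC.
apply: height_lt_threshold; rewrite ?Z_neq0 ?(edges_gt0 R hn).1 ?(edges_gt0 R hn).2//.
by rewrite expr1n mulr1 ltr_nat; lia.
Qed.

End shift_types.

Theorem theorem1p1 (R : realType) (L Z : R) (N n : nat)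
    (hL : 0 <= L) (hZ : Z < 0) (hN : (2 <= N)%N) (hn : (1 <= n <= N - 1)%N) :
  exists aA aB a1 aN : R -> R,
    let Th := fun omega => Theta L N n omega (a1 omega) (aN omega) in
    [/\ (* existence of the shifts *)
        forall omega, omega_star Z N n < omega ->
          ((N < 2 * n)%N -> omega <> omega_hat Z N) ->
          [/\ 0 < aA omega < aB omega,
              typeA (aA omega), typeB (aB omega),
              [set a1 omega; aN omega] = [set aA omega; aB omega] &
              stationary_solution L Z omega (Th omega) /\
              deltap_dom L Z (Th omega)],
        (* smooth curve of standing waves *)
        (forall t, smooth_curve L Z [set omega | omega_star Z N n < omega]
                     (fun omega => rotate (t * omega) (Th omega))) /\
        (forall omega, omega_star Z N n < omega ->
           standing_wave L Z omega (Th omega)),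
        (* discontinuity at the vertex *)
        forall omega, omega_star Z N n < omega ->
          ((N < 2 * n)%N -> omega <> omega_hat Z N) ->
          forall t, ~ continuous_at_vertex L (rotate (t * omega) (Th omega)),
        (* assignment of the shift types, 2n <= N *)
        (2 * n <= N)%N -> forall omega, omega_star Z N n < omega ->
          a1 omega = aA omega /\ aN omega = aB omega &
        (* assignment of the shift types, 2n > N *)
        (N < 2 * n)%N ->
        [/\ forall omega, omega_hat Z N < omega ->
              a1 omega = aA omega /\ aN omega = aB omega,
            forall omega, omega_star Z N n < omega < omega_hat Z N ->
              a1 omega = aB omega /\ aN omega = aA omega &
            [/\ aA (omega_hat Z N) = artanh (1 / Num.sqrt 2),
                aB (omega_hat Z N) = artanh (1 / Num.sqrt 2),
                a1 (omega_hat Z N) = artanh (1 / Num.sqrt 2),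
                aN (omega_hat Z N) = artanh (1 / Num.sqrt 2) &
                continuous_at_vertex L (Th (omega_hat Z N))]]].
Proof.
have [n0 m0] := edges_gt0 R hn.
(* The implication makes the statement total in [w], with the dummy value 0 elsewhere, so that
   [choice] yields a function on the whole line. *)
have root_ex w : exists y, frequencies Z N n w ->
    [/\ 0 < y, (N - n)%:R * y ^+ 3 < n%:R & height n%:R (N - n)%:R y = Z ^+ 2 * w].
  have [Iw|] := pselect (frequencies Z N n w); last by exists 0.
  by have [y] := height_root n0 m0 (Z_neq0 hZ) Iw; exists y.
have [r rP] := choice root_ex.
pose a1 w := shift_of r true w; pose aN w := shift_of r false w.
have a1_lt w : frequencies Z N n w -> r w < 1 -> a1 w < a_star < aN w.
  move=> /rP[r0 _ _] r1; rewrite a_starE !ltr_arsinh r1 /=.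
  by rewrite invf_gt1.
have a1_gt w : frequencies Z N n w -> 1 < r w -> aN w < a_star < a1 w.
  move=> /rP[r0 _ _] r1; rewrite a_starE !ltr_arsinh r1 andbT.
  by rewrite invf_lt1.
have r_neq1 w : frequencies Z N n w -> ((N < 2 * n)%N -> w <> omega_hat Z N) -> r w <> 1.
  move=> Iw; case: (leqP (2 * n) N) => [nN _ r1|Nn /(_ isT) /eqP].
    by have := root_lt1 hZ hn rP nN Iw; rewrite r1 ltxx.
  rewrite neq_lt => /orP[]; have := root_omega_hat hZ hn rP Nn Iw => -[e1 e2];
    by rewrite -?e1 -?e2 => + r1; rewrite r1 ltxx.
(* The types come from sorting the two shifts at each frequency, whereas the curve follows [a1] and
   [aN], which remain smooth where they cross. *)
exists (fun w => Num.min (a1 w) (aN w)), (fun w => Num.max (a1 w) (aN w)), a1, aN.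
move=> Th; split.
- move=> w Iw /(r_neq1 w Iw) /eqP; rewrite neq_lt => r1.
  have [a10 aN0] : 0 < a1 w /\ 0 < aN w.
    by split; apply: (shift_of_gt0 (I := frequencies Z N n)) => // v /rP[].
  have stat_wave := stationary_solution_wave L hZ hn rP Iw.
  have dom_wave := deltap_dom_wave L hZ hn rP Iw.
  rewrite /typeA /typeB; case/orP: r1 => r1.
    have /andP[l1 l2] := a1_lt w Iw r1; have l3 := lt_trans l1 l2.
    by rewrite min_l ?max_r ?(ltW l3)//; split=> //; apply/andP.
  have /andP[l1 l2] := a1_gt w Iw r1; have l3 := lt_trans l1 l2.
  rewrite min_r ?max_l ?(ltW l3)//; split=> //; [exact/andP|exact/andP|].
  exact: setUC.
- split=> [t|w Iw]; first exact: (smooth_curve_wave L hZ hn rP).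
  split; first exact: (deltap_dom_wave L hZ hn rP).
  exact: (NLS_solution_wave L hZ hn rP).
- move=> w Iw hw t; apply: (discontinuous_wave hZ hn rP) => //.
  exact: r_neq1.
- move=> nN w Iw; have /andP[l1 l2] := a1_lt w Iw (root_lt1 hZ hn rP nN Iw).
  by have l3 := lt_trans l1 l2; rewrite min_l ?max_r ?(ltW l3).
- move=> Nn.
  have Ihat : frequencies Z N n (omega_hat Z N) := frequencies_omega_hat hZ hn Nn.
  split=> [w hw|w /andP[Iw hw]|].
  + have Iw : frequencies Z N n w by exact: lt_trans hw.
    have /andP[l1 l2] : a1 w < a_star < aN w.
      by apply: a1_lt => //; rewrite (root_omega_hat hZ hn rP Nn Iw).
    by have l3 := lt_trans l1 l2; rewrite min_l ?max_r ?(ltW l3).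
  + have /andP[l1 l2] : aN w < a_star < a1 w.
      by apply: a1_gt => //; rewrite (root_omega_hat hZ hn rP Nn Iw).
    by have l3 := lt_trans l1 l2; rewrite min_r ?max_l ?(ltW l3).
  + have r1 : r (omega_hat Z N) = 1.
      have := root_omega_hat hZ hn rP Nn Ihat; rewrite ltxx => -[h1 h2].
      by apply/eqP; rewrite eq_le !leNgt h1 h2.
    have a1E : a1 (omega_hat Z N) = a_star by rewrite /a1 /shift_of r1 a_starE.
    have aNE : aN (omega_hat Z N) = a_star by rewrite /aN /shift_of r1 invr1 a_starE.
    rewrite /Th a1E aNE minxx maxxx; split=> // i j.
    by rewrite /Theta !if_same.
Qed.
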